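(* Let $n\ge1$, let $T$ be a noncrossing tree on the vertex set $[n+1]$, and let $P_n^{\mathcal{S}}$ be a reduced form of the commutative monomial $m^{\mathcal{S}}[T]$. Then $$P_n^{\mathcal{S}}(x_{ij}=1,\ \beta=0)=f_T,$$ where $f_T$ denotes the number of noncrossing alternating spanning trees of $\overline{T}$. If the edges of $T$ are labeled so that $T$ becomes a good tree, then the reduced form $P_n^{\mathcal{B}}$ of the noncommutative monomial $m^{\mathcal{B}}[T]$ satisfies $$P_n^{\mathcal{B}}(x_{ij},\ \beta=0)=\sum_{T_0}x^{T_0},$$ where the sum runs over all noncrossing alternating spanning trees $T_0$ of $\overline{T}$ with lexicographic edge-labels, and $x^{T_0}$ is the noncommutative monomial $\prod_{l=1}^n x_{i_l,j_l}$ if $T_0$ contains the edges $(i_1,j_1)_1,\ldots,(i_n,j_n)_n$.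
   Context: Graphs have vertex set $[n+1]=\{1,\ldots,n+1\}$; an edge joining $i<j$ is written $(i,j)$, and $(i,j)_a$ denotes the edge $(i,j)$ with label $a$. A graph is noncrossing if there are no $i<j<k<l$ with $(i,k),(j,l)$ both edges; alternating if there are no $i<j<k$ with $(i,j),(j,k)$ both edges. The transitive closure $\overline{G}$ has as edges all $(i,j)$ for which there are edges $(i,i_1),(i_1,i_2),\ldots,(i_r,j)$ of $G$ with $i<i_1<\cdots<i_r<j$ (edges of $G$ included). A spanning tree of $\overline{T}$ is a tree with vertex set $[n+1]$ with all edges in $\overline{T}$. Monomials: $m^{\mathcal{S}}[G]=\prod_{(i,j)\in E(G)}x_{ij}$ in commuting variables $x_{ij}$, $1\le i<j\le n+1$. If the edges of $G$ are labeled $1,\ldots,k$ as $(i_1,j_1)_1,\ldots,(i_k,j_k)_k$, then $m^{\mathcal{B}}[G]=x_{i_1j_1}x_{i_2j_2}\cdots x_{i_kj_k}$, a noncommutative monomial. Reductions: the reduction rule is $x_{ij}x_{jk}\to x_{ik}x_{ij}+x_{jk}x_{ik}+\beta x_{ik}$ for $i<j<k$, where $\beta$ is a central variable, applied to a pair of adjacent variables in one monomial of a polynomial at a time. A reduced form in the commutative case is a polynomial obtained from the monomial by successive applications of this rule until no further reduction is possible, where any two variables may be commuted between reductions. In the noncommutative case it is defined the same way, but only variables $x_{ij},x_{kl}$ with $i,j,k,l$ distinct may be commuted between reductions; reduction terminates when no monomial can be reduced even after such commutations. Noncommutative polynomials are considered up to these commutations. A forest $H$ on $[n+1]$ with $k$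 edges labeled $1,\ldots,k$ is good if: (i) if $(i,j)_a,(j,k)_b$ are edges, $i<j<k$, then $a<b$; (ii) if $(i,j)_a,(i,k)_b$ are edges with $i<j<k$, then $a>b$; (iii) if $(i,j)_a,(k,j)_b$ are edges with $i<k<j$, then $a>b$; (iv) $H$ is noncrossing. A good tree is a good forest that is a tree. Lexicographic edge-labels: edge $(i_1,j_1)$ is less than $(i_2,j_2)$ if $j_1>j_2$, or $j_1=j_2$ and $i_1>i_2$. A graph with $k$ edges has lexicographic edge-labels if its edges are labeled $1,\ldots,k$ increasingly with respect to this order. *)

(* Defs.v *)
From Stdlib Require Import Relation_Operators.
From HB Require Import structures.
From mathcomp Require Import all_boot all_order all_algebra finmap.
From mathcomp Require Import generic_quotient monalg.
From mathcomp Require boolp.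

Set Implicit Arguments.
Unset Strict Implicit.
Unset Printing Implicit Defensive.

Import Order.TTheory GRing.Theory Num.Theory.
Local Open Scope ring_scope.

(* The vertex i of [n+1] is the ordinal of value i - 1. A pair (i, j) is an   *)
(* edge only if i < j: this is imposed by [graph], and the variable x_ij is   *)
(* used only for i < j.                                                       *)
Notation edge n := ('I_n.+1 * 'I_n.+1)%type.

Section Graphs.
Local Open Scope nat_scope.
Variable n : nat.
Implicit Types (E T : {set edge n}) (s : seq (edge n)).

Definition graph E := [forall e : edge n in E, e.1 < e.2].

Definition adj E : rel 'I_n.+1 := fun i j => ((i, j) \in E) || ((j, i) \in E).

Definition connected E := [forall i, forall j, connect (adj E) i j].

(* A cycle is a [ucycle] of length at least 3; being duplicate-free it has at *)
(* most n + 1 vertices. A [ucycle] of length 2 only runs along an edge and    *)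
(* back.                                                                      *)
Definition acyclic E :=
  [forall c : n.+1.-bseq 'I_n.+1, (2 < size c) ==> ~~ ucycleb (adj E) c].

Definition forest E := graph E && acyclic E.

Definition tree E := forest E && connected E.

Definition noncrossing E :=
  [forall i : 'I_n.+1, forall j : 'I_n.+1, forall k : 'I_n.+1,
   forall l : 'I_n.+1,
   [&& i < j, j < k & k < l] ==> ~~ (((i, k) \in E) && ((j, l) \in E))].

Definition alternating E :=
  [forall i : 'I_n.+1, forall j : 'I_n.+1, forall k : 'I_n.+1,
   (i < j) && (j < k) ==> ~~ (((i, j) \in E) && ((j, k) \in E))].

(* The strict inequality excludes the empty path; paths along edges of a      *)
(* [graph] have increasing vertices.                                          *)
Definition tclosure E : {set edge n} :=
  [set e : edge n | (e.1 < e.2) && connect (fun a b => (a, b) \in E) e.1 e.2].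

Definition spanning_tree E T := tree T && (T \subset E).

Definition nc_alt_trees T : {set {set edge n}} :=
  [set T0 | [&& spanning_tree (tclosure T) T0, noncrossing T0
              & alternating T0]].

(* A graph with edges labeled 1, .., k is the sequence of its edges in the    *)
(* order of their labels: the label of e \in s is (index e s).+1.             *)
Definition edges_of s : {set edge n} := [set e in s].

Definition good_forest s : Prop :=
  [/\ uniq s /\ forest (edges_of s),
      forall i j k : 'I_n.+1, i < j -> j < k ->
        (i, j) \in s -> (j, k) \in s -> index (i, j) s < index (j, k) s,
      forall i j k : 'I_n.+1, i < j -> j < k ->
        (i, j) \in s -> (i, k) \in s -> index (i, k) s < index (i, j) s,
      forall i j k : 'I_n.+1, i < k -> k < j ->
        (i, j) \in s -> (k, j) \in s -> index (k, j) s < index (i, j) s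
    & noncrossing (edges_of s)].

Definition good_tree s : Prop := good_forest s /\ tree (edges_of s).

(* Reflexive version of the order of lexicographic edge-labels. *)
Definition lexle : rel (edge n) := fun e f =>
  (f.2 < e.2) || (e.2 == f.2) && (f.1 <= e.1).

Definition lex_labeling T : seq (edge n) := sort lexle (enum T).

End Graphs.

(* The free partially commutative monoid: words over V up to the commutation  *)
(* of the adjacent letters related by r.                                      *)
Section PartiallyCommutativeMonoid.
Local Open Scope quotient_scope.
Variables (V : choiceType) (r : rel V).

Inductive commute_step : fmonom V -> fmonom V -> Prop :=
  CommuteStep (u v : fmonom V) (a b : V) : r a b ->
    commute_step (mmul (mmul u (mmul (fmu a) (fmu b))) v)
                 (mmul (mmul u (mmul (fmu b) (fmu a))) v).

Definition commute_equiv (w1 w2 : fmonom V) : Prop :=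
  clos_refl_sym_trans (fmonom V) commute_step w1 w2.

Definition commute_eqb : rel (fmonom V) :=
  fun w1 w2 => boolp.asbool (commute_equiv w1 w2).

Lemma commute_eqb_refl : reflexive commute_eqb.
Proof. by move=> w; apply/boolp.asboolP; apply: rst_refl. Qed.

Lemma commute_eqb_sym : symmetric commute_eqb.
Proof.
move=> w1 w2; apply/boolp.asboolP/boolp.asboolP; exact: rst_sym.
Qed.

Lemma commute_eqb_trans : transitive commute_eqb.
Proof.
move=> w2 w1 w3 /boolp.asboolP h12 /boolp.asboolP h23.
apply/boolp.asboolP; exact: rst_trans h12 h23.
Qed.

Canonical commute_eqb_equiv :=
  EquivRel commute_eqb commute_eqb_refl commute_eqb_sym commute_eqb_trans.

Definition pcmonom : Type := {eq_quot commute_eqb}.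
HB.instance Definition _ := Choice.on pcmonom.
HB.instance Definition _ := Quotient.on pcmonom.

Lemma pcmonomP (w1 w2 : fmonom V) :
  \pi_pcmonom w1 = \pi_pcmonom w2 <-> commute_equiv w1 w2.
Proof.
split=> [/eqmodP h|h]; first by apply/boolp.asboolP.
by apply/eqmodP; apply/boolp.asboolP.
Qed.

Definition pcone : pcmonom := \pi_pcmonom (mone : fmonom V).
Definition pcmul (x y : pcmonom) : pcmonom :=
  \pi_pcmonom (mmul (repr x) (repr y)).

Lemma commute_equivM (w1 w1' w2 w2' : fmonom V) :
  commute_equiv w1 w1' -> commute_equiv w2 w2' ->
  commute_equiv (mmul w1 w2) (mmul w1' w2').
Proof.
move=> h1 h2; apply: (@rst_trans _ _ _ (mmul w1' w2)).
  elim: h1 => {w1 w1'} [_ _ [u v a b rab]|w|w w' _|w w' w'' _ h _].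
  - by apply: rst_step; rewrite -!(mulmA _ v); constructor.
  - exact: rst_refl.
  - exact: rst_sym.
  - exact: rst_trans h.
elim: h2 => {w2 w2'} [_ _ [u v a b rab]|w|w w' _|w w' w'' _ h _].
- by apply: rst_step; rewrite !(mulmA w1'); constructor.
- exact: rst_refl.
- exact: rst_sym.
- exact: rst_trans h.
Qed.

Lemma pcmul_pi (w1 w2 : fmonom V) :
  pcmul (\pi w1) (\pi w2) = \pi_pcmonom (mmul w1 w2).
Proof.
apply/pcmonomP; apply: commute_equivM; apply/pcmonomP; exact: reprK.
Qed.

Lemma pcmulA : associative pcmul.
Proof.
elim/quotW=> x; elim/quotW=> y; elim/quotW=> z.
by rewrite !pcmul_pi mulmA.
Qed.

Lemma pcmul1m : left_id pcone pcmul.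
Proof. by elim/quotW=> x; rewrite pcmul_pi mul1m. Qed.

Lemma pcmulm1 : right_id pcone pcmul.
Proof. by elim/quotW=> x; rewrite pcmul_pi mulm1. Qed.

Lemma commute_equiv_fdeg (w1 w2 : fmonom V) :
  commute_equiv w1 w2 -> fdeg w1 = fdeg w2.
Proof.
elim=> [_ _ [u v a b rab]|//|//|w w' w'' _ h _ h']; last by rewrite h.
by rewrite !fdegM !fdegU.
Qed.

Lemma pcmul_eq1 (x y : pcmonom) : pcmul x y = pcone -> x = pcone /\ y = pcone.
Proof.
elim/quotW: x => x; elim/quotW: y => y; rewrite pcmul_pi => /pcmonomP.
move=> /commute_equiv_fdeg; rewrite fdegM fdeg1 => /eqP.
by rewrite addn_eq0 => /andP[/eqP/fdeg_eq0I-> /eqP/fdeg_eq0I->].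
Qed.

HB.instance Definition _ :=
  Choice_isMonomialDef.Build pcmonom pcmulA pcmul1m pcmulm1 pcmul_eq1.

Definition pcu (a : V) : pcmonom := \pi_pcmonom (fmu a).

End PartiallyCommutativeMonoid.

(* x_ij and x_kl commute when i, j, k, l are distinct. *)
Definition disjoint_edges (n : nat) : rel (edge n) :=
  fun e f => uniq [:: e.1; e.2; f.1; f.2].

Definition ncmonom (n : nat) := pcmonom (@disjoint_edges n).

HB.instance Definition _ n := MonomialDef.on (ncmonom n).

Definition xS (n : nat) (e : edge n) : {cmonom edge n} := ucm e.
Definition xB (n : nat) (e : edge n) : ncmonom n := pcu (@disjoint_edges n) e.

Definition monS (n : nat) (E : {set edge n}) : {cmonom edge n} :=
  \big[mmul/mone]_(e in E) xS e.

Definition monB (n : nat) (s : seq (edge n)) : ncmonom n :=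
  \big[mmul/mone]_(e <- s) xB e.

(* Polynomials over Z in beta and the variables x, whose monomials form the   *)
(* monoid M, are the elements of {malg {poly int}[M]}: beta is the            *)
(* indeterminate 'X of the coefficient ring. The commutation of variables     *)
(* between reductions is built into M.                                        *)
Section Reduction.
Variables (n : nat) (M : monomType) (x : edge n -> M).
Local Notation polyM := {malg {poly int}[M]}.

(* c copies of a monomial beta^e u x_ij x_jk v that occurs at least c times   *)
(* in p are replaced, so that a step may rewrite a single occurrence of a     *)
(* monomial as well as the monomial with its whole coefficient. The           *)
(* coefficients remain nonnegative all along.                                 *)
Definition red_step (p q : polyM) : Prop :=
  exists (u v : M) (i j k : 'I_n.+1) (e : nat) (c : int),
    let m (y : M) := mmul (mmul u y) v in
    [/\ (i < j)%N, (j < k)%N,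
        0 < c <= (p@_(m (mmul (x (i, j)) (x (j, k)))))`_e
      & q = p + (c *: 'X^e) *:
            (<< m (mmul (x (i, k)) (x (i, j))) >>
             + << m (mmul (x (j, k)) (x (i, k))) >>
             + << 'X *g m (x (i, k)) >>
             - << m (mmul (x (i, j)) (x (j, k))) >>)].

Definition irreducible_monom (m : M) : Prop :=
  forall (u v : M) (i j k : 'I_n.+1), (i < j)%N -> (j < k)%N ->
    m <> mmul (mmul u (mmul (x (i, j)) (x (j, k)))) v.

Definition reduced_form (m : M) (p : polyM) : Prop :=
  clos_refl_trans polyM red_step << m >> p /\
  {in msupp p, forall m', irreducible_monom m'}.

End Reduction.

Definition evalS (n : nat) (b : int) (a : edge n -> int)
    (p : {malg {poly int}[{cmonom edge n}]}) : int :=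
  mmap (fun c : {poly int} => c.[b])
       (fun m => \prod_(e <- finsupp (cmonom_val m)) a e ^+ m e) p.

Definition beta0 (M : monomType) (p : {malg {poly int}[M]}) : {malg int[M]} :=
  mmap (fun c : {poly int} => (c.[0])%:MP) (fun m => << m >>) p.

(* Main.v *)
(* At beta = 0 a reduction replaces the tree T by two trees T1 and T2 (edges
   ij, jk become ij, ik and jk, ik), so it suffices to find a functional on
   monomials that is additive under this splitting and takes the right value on
   irreducible monomials; its value on the initial monomial is then the one of
   any reduced form.

   Noncommutative case: goodness forces ij and jk to be the longest edges
   ending and starting at j, whence T1 and T2 are again good, and the
   noncrossing alternating spanning trees of the closure of T are split between
   those of T1 and T2. The functional is the right-hand side of the theorem. A
   good word that is irreducible is alternating, and then T is the only
   noncrossing alternating spanning tree of its closure.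

   Commutative case: crossing trees occur, and the functional is a discrete
   volume of the root cone. Count the positive integer vectors c on the edges
   according to the value of the sum of the positive parts of
   sum_e c_e (e_i - e_j): comparing c_ij with c_jk makes this additive under
   the full rule, beta term included, and for an alternating graph with d edges
   it counts the compositions into d parts. The (n-1)-st finite difference
   kills d < n and normalizes d = n to 1. On noncrossing trees it is f_T by
   induction, reducing longest edges only. *)

Require Import Defs.
From Stdlib Require Import Relation_Operators.
From mathcomp Require Import all_boot all_order all_algebra finmap monalg.
From mathcomp Require Import generic_quotient zify.
From mathcomp Require boolp.

Import Order.TTheory GRing.Theory Num.Theory.
Local Open Scope ring_scope.

(** * Noncrossing trees *)

Section Graph.
Local Open Scope nat_scope.
Variable n : nat.
Implicit Types (E F T : {set edge n}) (e f : edge n).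
Implicit Types (a b c d i j k x y z : 'I_n.+1).

(** * Undirected connectivity, bridges and trees *)

Local Notation linked E := (connect (adj E)).

Lemma graphP E : reflect {in E, forall e, e.1 < e.2} (graph E).
Proof. exact: forall_inP. Qed.

Lemma linked_sym E : connect_sym (adj E).
Proof. by apply: sym_connect_sym => x y; rewrite /adj orbC. Qed.

Lemma linked1 E e : e \in E -> linked E e.1 e.2.
Proof. by move=> eE; apply: connect1; rewrite /adj -surjective_pairing eE. Qed.

Lemma linkedS E F x y : E \subset F -> linked E x y -> linked F x y.
Proof.
move=> /subsetP EF; apply: connect_sub => {}x {}y /orP h.
by apply: connect1; rewrite /adj; case: h => /EF -> //; rewrite orbT.
Qed.

(** A walk can be shortened so as to cross the added edge at most once, in one direction or the
    other. *)
Lemma linkedU1 E e x y : linked (e |: E) x y ->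
  [\/ linked E x y, linked E x e.1 /\ linked E e.2 y
    | linked E x e.2 /\ linked E e.1 y].
Proof.
case/connectP=> p; elim: p x => [|z p IHp] x /=.
  by move=> _ ->; constructor 1; apply: connect0.
case/andP=> xz /IHp{}IHp /IHp{IHp} zy.
have [xzE | [[-> zE] | [-> zE]]] :
    adj E x z \/ ((x = e.1 /\ z = e.2) \/ (x = e.2 /\ z = e.1)).
- by move: xz; rewrite /adj !in_setU1 => /orP[]/orP[/eqP<-|h]; rewrite ?h ?orbT; auto.
- have tr w : linked E z w -> linked E x w.
    by apply: connect_trans; apply: connect1.
  by case: zy => [/tr|[/tr ? ?]|[/tr ? ?]]; [constructor 1|constructor 2|constructor 3].
- by rewrite zE in zy; case: zy => [?|[_ ?]|[_ ?]];
    [constructor 2|constructor 2|constructor 1].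
- by rewrite zE in zy; case: zy => [?|[_ ?]|[_ ?]];
    [constructor 3|constructor 1|constructor 3].
Qed.

(** Acyclicity restated: every edge is a bridge. In this form it passes to subsets and behaves well
    when edges are exchanged. *)
Definition bridged E := [forall e in E, ~~ linked (E :\ e) e.1 e.2].

Lemma bridgedP E :
  reflect {in E, forall e, ~~ linked (E :\ e) e.1 e.2} (bridged E).
Proof. exact: forall_inP. Qed.

Lemma bridgedS E F : E \subset F -> bridged F -> bridged E.
Proof.
move=> EF /bridgedP bF; apply/bridgedP=> e eE.
by apply: contra (bF e (subsetP EF e eE)); apply: linkedS; apply: setSD.
Qed.

(** If an old edge [f] stopped being a bridge, its ends would be linked through [e]; going around
    through [f] would then link the ends of [e] within [E]. *)
Lemma bridgedU1 E e : bridged E -> ~~ linked E e.1 e.2 -> bridged (e |: E).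
Proof.
move=> /bridgedP bE ne; apply/bridgedP=> f; rewrite in_setU1.
have [-> _|fe /= fE] := eqVneq f e.
  apply: contra ne; apply: linkedS.
  by apply/subsetP=> x; rewrite !inE => /andP[/negPf->].
have sE : E :\ f \subset E by apply: subsetDl.
apply/negP; rewrite (_ : _ :\ f = e |: (E :\ f)); last first.
  apply/setP=> x; rewrite !inE.
  by case: (eqVneq x e) => // ->; rewrite eq_sym fe.
case/linkedU1 => [h|[h1 h2]|[h1 h2]]; first by rewrite (negPf (bE f fE)) in h.
  case/negP: ne; apply: connect_trans (_ : linked E e.1 f.1) _.
    by rewrite linked_sym; apply: linkedS h1.
  apply: connect_trans (linked1 _ _ fE) _.
  by rewrite linked_sym; apply: linkedS h2.
case/negP: ne; rewrite linked_sym; apply: connect_trans (_ : linked E e.2 f.1) _.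
  by rewrite linked_sym; apply: linkedS h1.
apply: connect_trans (linked1 _ _ fE) _.
by rewrite linked_sym; apply: linkedS h2.
Qed.

Lemma acyclic_bridged E : graph E -> acyclic E -> bridged E.
Proof.
move=> /graphP gE /forallP acE; apply/bridgedP=> e eE; apply/negP.
case/connectP=> p0 p0E; case/shortenP: p0E => p pE up _ le.
have e12 := gE e eE.
have szp : size (e.1 :: p) <= n.+1.
  by rewrite -(card_uniqP up) -[X in _ <= X]card_ord max_card.
have := acE (Bseq szp); rewrite /= => /implyP; case: p pE up le szp => [|x [|y p]].
- by move=> _ _ /= h; rewrite h ltnn in e12.
(* As [e] is removed, a path of length one would use the reversed pair [(e.2, e.1)], which is not
   increasing. *)
- rewrite /= andbT /adj !inE => h _ /= xe _; move: h; rewrite -xe.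
  rewrite -surjective_pairing eqxx /= => /andP[_ /gE] /=.
  by move=> h; move: (ltn_trans h e12); rewrite ltnn.
- move=> pE up le _ h; move/negP: (h isT); apply; apply/andP; split=> //=.
  rewrite /= in pE le; case/and3P: pE => xy yz pE.
  have aS : subrel (adj (E :\ e)) (adj E).
    by move=> u v /orP[]; rewrite /adj !inE => /andP[_ ->]; rewrite ?orbT.
  rewrite (aS _ _ xy) (aS _ _ yz) /= rcons_path (sub_path aS pE) /= -le.
  by rewrite /adj -surjective_pairing eE orbT.
Qed.

(** A cycle without its first step still links the ends [x], [y] of that step; each remaining step
    has an end other than [x] and [y], so it avoids the removed edge. *)
Lemma bridged_acyclic E : graph E -> bridged E -> acyclic E.
Proof.
move=> /graphP gE /bridgedP bE; apply/forallP=> -[c szc] /=.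
apply/implyP; case: c szc => [|x [|y [|z c]]] // _ _; apply/negP.
case/andP=> /= /and3P[xy yz cx] /and4P[]; rewrite !inE !negb_or => /and3P[xney xnez xc].
case/andP=> ynez yc zc uc.
pose e := if (x, y) \in E then (x, y) else (y, x).
have eE : e \in E by rewrite /e; move: xy; rewrite /adj; case: ifP.
have eP u v : adj E u v -> (u != x) -> (u != y) -> adj (E :\ e) u v.
  move=> uv ux uy; move: uv; rewrite /adj !inE.
  rewrite /e; case: ifP => _; rewrite !xpair_eqE (negPf ux) (negPf uy) /= ?andbF //=.
have ypx : linked (E :\ e) y x.
  have nyx : z != x by rewrite eq_sym.
  apply: (@connect_trans _ _ z).
    rewrite linked_sym; apply/connect1/eP => //; last by rewrite eq_sym.
    by rewrite /adj orbC.
  apply/connectP; exists (rcons c x); last by rewrite last_rcons.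
  have := cx; rewrite !rcons_path => /andP[pc lx].
  have inzc : all (fun u => (u != x) && (u != y)) (z :: c).
    apply/allP=> u; rewrite inE => /predU1P[->|uc'].
      by rewrite nyx eq_sym.
    by apply/andP; split; [apply: contraNneq xc | apply: contraNneq yc] => <-.
  apply/andP; split.
    clear - pc inzc eP; elim: c z pc inzc => //= w c IHc z
      /andP[zw pc] /and3P[/andP[? ?] wxy ac].
    by rewrite eP //= IHc //= wxy.
  move/allP: inzc => /(_ (last z c) (mem_last _ _))/andP[? ?].
  exact: eP.
case/negP: (bE e eE); have [[-> ->] | [-> ->]] : e.1 = x /\ e.2 = y \/ e.1 = y /\ e.2 = x.
- by rewrite /e; case: ifP; auto.
- by rewrite linked_sym.
- exact: ypx.
Qed.

Lemma treeP T :
  reflect [/\ graph T, bridged T & forall x y, linked T x y] (tree T).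
Proof.
apply: (iffP andP) => [[/andP[gT aT] /forallP cT]|[gT bT cT]].
  by split=> // [|x y]; [apply: acyclic_bridged|have /forallP := cT x].
split; first by apply/andP; split=> //; apply: bridged_acyclic.
by apply/forallP=> x; apply/forallP.
Qed.

(** No cycle arises because [f] joins two components of [T :\ e]; connectedness survives because
    each passage through [e] can be rerouted. *)
Lemma tree_exchange T e f : tree T -> e \in T -> f.1 < f.2 ->
    ~~ linked (T :\ e) f.1 f.2 -> linked (f |: T :\ e) e.1 e.2 ->
  tree (f |: T :\ e).
Proof.
case/treeP=> /graphP gT bT cT eT fo nf lf; apply/treeP; split.
- apply/graphP=> x; rewrite !inE => /predU1P[-> //|/andP[_]]; exact: gT.
- by apply: bridgedU1 nf; apply: bridgedS bT; apply: subsetDl.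
move=> x y; have := cT x y; apply: connect_sub => u v uv.
have [xe|ne] := boolP (((u, v) == e) || ((v, u) == e)).
  case/orP: xe lf => /eqP xe; rewrite -[in e.1]xe -[in e.2]xe //=.
  by rewrite linked_sym.
move: uv ne; rewrite negb_or /adj => /orP[]h /andP[h1 h2]; apply: connect1;
  by rewrite /adj !inE ?h h1 h2 /= ?orbT.
Qed.

(** [R] holds one vertex of each component, so this counts the components of a forest. By induction
    on the edges: putting [e] back merges two components, and one of their two representatives is
    dropped. *)
Lemma bridged_transversal E : bridged E ->
  exists R : {set 'I_n.+1},
    [/\ #|R| + #|E| = n.+1, forall x, exists2 r, r \in R & linked E r x
      & {in R &, forall r s, linked E r s -> r = s}].
Proof.
have [m] := ubnP #|E|; elim: m E => // m IHm E; rewrite ltnS => szE bE.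
have [->|[e eE]] := set_0Vmem E.
  exists setT; rewrite cards0 addn0 cardsT card_ord; split=> //.
    by move=> x; exists x; rewrite ?inE.
  move=> r s _ _ /connectP[[|z p]] /=; first by move=> _ ->.
  by rewrite /adj !inE.
have [||R [cR exR uR]] := IHm (E :\ e).
- by move: szE; rewrite (cardsD1 e) eE; lia.
- by apply: bridgedS bE; apply: subsetDl.
have nE : ~~ linked (E :\ e) e.1 e.2 by move/bridgedP: bE; apply.
have eqE : E = e |: (E :\ e) by rewrite setD1K.
have sub x y : linked (E :\ e) x y -> linked E x y.
  by apply: linkedS; apply: subsetDl.
have [ra raR la] := exR e.1; have [rb rbR lb] := exR e.2.
have rab : ra != rb.
  apply: contra nE => /eqP rr; rewrite rr in la; apply: connect_trans lb.
  by rewrite linked_sym.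
exists (R :\ rb); split.
- have := cardsD1 rb R; have := cardsD1 e E; rewrite rbR eE; lia.
- move=> x; have [r rR lr] := exR x; have [rE|nr] := eqVneq r rb.
    exists ra; first by rewrite !inE rab.
    apply: connect_trans (sub _ _ la) _; apply: connect_trans (linked1 _ _ eE) _.
    apply: sub; apply: connect_trans (_ : linked _ _ rb) _; last by rewrite -rE.
    by rewrite linked_sym.
  by exists r; [rewrite !inE nr|apply: sub].
- have key r s : r \in R -> s \in R -> s != rb ->
      linked (E :\ e) e.2 s -> False.
    move=> rR sR sb h; case/eqP: sb; apply/esym/uR => //.
    exact: connect_trans lb h.
  move=> r s; rewrite !inE => /andP[nr rR] /andP[ns sR].
  rewrite [in linked _ _ _]eqE; case/linkedU1 => [|[_ h]|[h _]].
  + exact: uR.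
  + by case: (key r s).
  + by rewrite linked_sym in h; case: (key s r).
Qed.

Lemma tree_card T : tree T -> #|T| = n.
Proof.
case/treeP=> _ bT cT; have [R [cR exR uR]] := bridged_transversal _ bT.
suff R1 : #|R| = 1 by rewrite R1 in cR; case: cR.
have [r rR _] := exR ord0; apply/eqP/cards1P; exists r; apply/setP=> s.
rewrite !inE; apply/idP/eqP=> [sR|->//]; exact: uR.
Qed.

Lemma noncrossingP E : reflect
  (forall a b c d, a < b -> b < c -> c < d -> (a, c) \in E -> (b, d) \in E ->
     False)
  (noncrossing E).
Proof.
apply: (iffP forallP) => [nE a b c d ab bc cd acE bdE|nE a].
  have /forallP/(_ b)/forallP/(_ c)/forallP/(_ d) := nE a.
  by rewrite ab bc cd acE bdE.
apply/forallP=> b; apply/forallP=> c; apply/forallP=> d; apply/implyP.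
by case/and3P=> ab bc cd; apply/negP=> /andP[]; apply: nE.
Qed.

Lemma alternatingP E : reflect
  (forall a b c, a < b -> b < c -> (a, b) \in E -> (b, c) \in E -> False)
  (alternating E).
Proof.
apply: (iffP forallP) => [aE a b c ab bc abE bcE|aE a].
  have /forallP/(_ b)/forallP/(_ c) := aE a.
  by rewrite ab bc abE bcE.
apply/forallP=> b; apply/forallP=> c; apply/implyP.
by case/andP=> ab bc; apply/negP=> /andP[]; apply: aE.
Qed.

Lemma noncrossingS E F : E \subset F -> noncrossing F -> noncrossing E.
Proof.
move=> /subsetP EF /noncrossingP nF; apply/noncrossingP=> a b c d ab bc cd acE bdE.
by apply: (nF a b c d) => //; apply: EF.
Qed.

(** * Increasing paths and outermost pairs of edges *)

Local Notation reach E := (connect (fun x y => (x, y) \in E)).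

Lemma reach1 E x y : (x, y) \in E -> reach E x y.
Proof. exact: connect1. Qed.

Lemma reach_ind E (P : 'I_n.+1 -> 'I_n.+1 -> Prop) :
    (forall y, P y y) ->
    (forall x z y, (x, z) \in E -> reach E z y -> P z y -> P x y) ->
  forall x y, reach E x y -> P x y.
Proof.
move=> P0 PS x y /connectP[p]; elim: p x => [|z p IHp] x /=.
  by move=> _ ->.
case/andP=> xz pE yl; apply: PS (xz) _ (IHp _ pE yl).
by apply/connectP; exists p.
Qed.

Lemma reachS E F x y : E \subset F -> reach E x y -> reach F x y.
Proof. by move=> /subsetP EF; apply: connect_sub => u v /EF/reach1. Qed.

Lemma reach_leq E x y : graph E -> reach E x y -> x <= y.
Proof.
move=> /graphP gE; move: x y; apply: reach_ind => // x z y /gE /= xz _.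
exact/leq_trans/ltnW.
Qed.

(** Vertices increase along a path, so a path using [e] starts at or before [e.1] and ends at or
    after [e.2]. *)
Lemma reachD1 E e x y : graph E -> reach E x y -> ~~ ((x <= e.1) && (e.2 <= y)) ->
  reach (E :\ e) x y.
Proof.
move=> gE; move: x y; apply: reach_ind => [y _|x z y xz zy IH nxy].
  exact: connect0.
have zy' := reach_leq _ _ _ gE zy.
apply: connect_trans (IH _); last first.
  by move/graphP: gE => /(_ _ xz) /= ?; lia.
apply: reach1; rewrite !inE xz andbT; apply: contra nxy => /eqP <- /=.
by rewrite leqnn.
Qed.

Lemma reach_through E e x y :
  reach E x y -> reach (E :\ e) x y \/ reach E x e.1 /\ reach E e.2 y.
Proof.
move: x y; apply: reach_ind => [y|x z y xz zy IH].
  by left; apply: connect0.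
have [xze|ne] := eqVneq (x, z) e.
  by right; rewrite -xze.
have xzE : reach (E :\ e) x z by apply: reach1; rewrite !inE ne xz.
case: IH => [h|[h1 h2]]; [left|right].
  exact: connect_trans xzE h.
by split=> //; apply: connect_trans h1; apply: reach1.
Qed.

Definition outermost T i j k :=
  [/\ i < j < k, (i, j) \in T, (j, k) \in T,
      forall a, (a, j) \in T -> i <= a & forall b, (j, b) \in T -> b <= k].

Lemma exists_outermost T a j b : graph T -> (a, j) \in T -> (j, b) \in T ->
  exists i k, outermost T i j k.
Proof.
move=> /graphP gT aT bT.
case: (@arg_minnP _ a (fun i => (i, j) \in T) val aT) => i iT mi.
case: (@arg_maxnP _ b (fun k => (j, k) \in T) val bT) => k kT mk.
exists i, k; split=> //.
by rewrite (gT _ iT) (gT _ kT).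
Qed.

(** * Splitting a noncrossing tree at an outermost pair *)

Section Split.
Variables (T : {set edge n}) (i j k : 'I_n.+1).
Hypotheses (treeT : tree T) (ncT : noncrossing T) (oT : outermost T i j k).

Let T1 := (i, k) |: T :\ (j, k).
Let T2 := (i, k) |: T :\ (i, j).

Let ij : i < j. Proof. by case: oT => /andP[]. Qed.
Let jk : j < k. Proof. by case: oT => /andP[]. Qed.
Let ik : i < k. Proof. exact: ltn_trans ij jk. Qed.
Let ijT : (i, j) \in T. Proof. by case: oT. Qed.
Let jkT : (j, k) \in T. Proof. by case: oT. Qed.
Let gT : graph T. Proof. by case/treeP: treeT. Qed.
Let bT : bridged T. Proof. by case/treeP: treeT. Qed.

Let ijT1 : (i, j) \in T :\ (j, k).
Proof. by rewrite !inE ijT andbT xpair_eqE -val_eqE /= ltn_eqF. Qed.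

Let jkT2 : (j, k) \in T :\ (i, j).
Proof. by rewrite !inE jkT andbT xpair_eqE -val_eqE /= gtn_eqF. Qed.

(** Otherwise [(i, j)] would extend the link to one from [j] to [k] avoiding the bridge [(j, k)]. *)
Lemma split_unlinked1 : ~~ linked (T :\ (j, k)) i k.
Proof.
move/bridgedP: bT => /(_ _ jkT); apply: contra; apply: connect_trans.
by rewrite linked_sym; apply: (linked1 _ (i, j)).
Qed.

Lemma split_unlinked2 : ~~ linked (T :\ (i, j)) i k.
Proof.
move/bridgedP: bT => /(_ _ ijT); apply: contra => /connect_trans; apply.
by rewrite linked_sym; apply: (linked1 _ (j, k)).
Qed.

Lemma split_fresh : (i, k) \notin T.
Proof.
apply: contra split_unlinked1 => ikT; apply: (linked1 _ (i, k)).
by rewrite !inE ikT andbT xpair_eqE -val_eqE /= ltn_eqF.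
Qed.

Lemma split_tree1 : tree T1.
Proof.
apply: tree_exchange => //=; first exact: split_unlinked1.
apply: (@connect_trans _ _ i).
  rewrite linked_sym; apply: (linked1 _ (i, j)).
  by rewrite in_setU1 ijT1 orbT.
by apply: (linked1 _ (i, k)); rewrite setU11.
Qed.

Lemma split_tree2 : tree T2.
Proof.
apply: tree_exchange => //=; first exact: split_unlinked2.
apply: (@connect_trans _ _ k).
  by apply: (linked1 _ (i, k)); rewrite setU11.
rewrite linked_sym; apply: (linked1 _ (j, k)).
by rewrite in_setU1 jkT2 orbT.
Qed.

(** An edge crossing [(i, k)] has one end strictly between [i] and [k]. If that end is not [j], the
    edge already crosses [(i, j)] or [(j, k)]; if it is [j], the edge contradicts outermostness. *)
Lemma split_noncrossing : noncrossing ((i, k) |: T).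
Proof.
case: oT => _ _ _ mi mk; move/noncrossingP: ncT => nT.
apply/noncrossingP=> a b c d ab bc cd acE bdE; move: acE bdE ab bc cd.
rewrite !inE => /predU1P[[-> ->]|acT] /predU1P[[-> ->]|bdT] ab bc cd.
- by rewrite ltnn in ab.
- case: (ltngtP b j) => [bj|jb|/val_inj bj].
  + exact: (nT i b j d _ _ (ltn_trans jk cd)).
  + exact: (nT j b k d).
  + by rewrite bj in bdT; move: cd; rewrite ltnNge mk.
- case: (ltngtP c j) => [cj|jc|/val_inj cj].
  + exact: (nT a i c j).
  + exact: (nT a j c k (ltn_trans ab ij)).
  + by rewrite cj in acT; move: ab; rewrite ltnNge mi.
- exact: (nT a b c d).
Qed.

Lemma split_noncrossing1 : noncrossing T1.
Proof. by apply: noncrossingS split_noncrossing; apply/setUS/subsetDl. Qed.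

Lemma split_noncrossing2 : noncrossing T2.
Proof. by apply: noncrossingS split_noncrossing; apply/setUS/subsetDl. Qed.

(** A path to [j] cannot jump over [i]: an edge doing so would either end at [j], against the
    minimality of [i], or cross [(i, j)]. *)
Lemma reach_to_i a : reach T a j -> a <= i -> reach T a i.
Proof.
move/noncrossingP: ncT => nT; case: oT => _ _ _ mi _.
suff H : forall x y, reach T x y -> y = j -> x <= i -> reach T x i.
  by move=> /H; apply.
apply: reach_ind => [y -> ji|x z y xzT zy IH yj xi].
  by have := leq_trans ij ji; rewrite ltnn.
have [->|nxi] := eqVneq x i; first exact: connect0.
have {nxi}xi : x < i by rewrite ltn_neqAle nxi.
apply: connect_trans (reach1 _ _ _ xzT) (IH yj _); rewrite leqNgt; apply/negP=> iz.
have := reach_leq _ _ _ gT zy; rewrite yj leq_eqVlt => /predU1P[/val_inj zj|zj].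
  by rewrite zj in xzT; move: xi; rewrite ltnNge mi.
exact: (nT x i z j).
Qed.

(** An edge jumping over [k] would start at [j], against the maximality of [k], or cross [(j, k)].
    The induction lets the starting point range over the interval from [j] to [k]. *)
Lemma reach_from_k b : reach T j b -> k <= b -> reach T k b.
Proof.
move/noncrossingP: ncT => nT; case: oT => _ _ _ _ mk.
suff H : forall x y, reach T x y -> j <= x -> x <= k -> k <= y -> reach T k y.
  by move=> /H; apply=> //; apply: ltnW.
apply: reach_ind => [y _ yk ky|x z y xzT zy IH jx xk ky].
  suff -> : k = y by apply: connect0.
  by apply/val_inj/anti_leq; rewrite /= ky.
have [xk'|nxk] := eqVneq x k.
  by rewrite -xk'; apply: connect_trans (reach1 _ _ _ xzT) zy.
have {nxk}xk : x < k by rewrite ltn_neqAle nxk.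
have /= xz := (graphP _ gT) _ xzT.
apply: IH ky; first exact/ltnW/(leq_ltn_trans jx); rewrite leqNgt; apply/negP=> kz.
move: jx; rewrite leq_eqVlt => /predU1P[/val_inj jx|jx].
  by rewrite -jx in xzT; move: kz; rewrite ltnNge mk.
exact: (nT j x k z).
Qed.

(** A path through [(j, k)] that starts at or before [i] can pass through [i] and take [(i, k)]
    instead; only starts in the range from [i.+1] to [j] are lost. *)
Lemma reach_split1 a b : reach T a b ->
  reach T1 a b \/ (i < a <= j) && (k <= b).
Proof.
have sT1 : T :\ (j, k) \subset T1 by apply: subsetUr.
case/(reach_through _ (j, k)) => /= [h|[aj kb]]; first by left; apply: reachS h.
have /= ajl := reach_leq _ _ _ gT aj; have /= kbl := reach_leq _ _ _ gT kb.
have [ai|ia] := leqP a i; last by right; rewrite ajl.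
left; apply: (@connect_trans _ _ i).
  apply: reachS sT1 _; apply: reachD1 => //; first exact: reach_to_i.
  by rewrite /= negb_and -!ltnNge ik orbT.
apply: (@connect_trans _ _ k); first by apply: reach1; rewrite setU11.
apply: reachS sT1 _; apply: reachD1 => //.
by rewrite /= negb_and -!ltnNge jk.
Qed.

Lemma reach_split2 a b : reach T a b ->
  reach T2 a b \/ (a <= i) && (j <= b < k).
Proof.
have sT2 : T :\ (i, j) \subset T2 by apply: subsetUr.
case/(reach_through _ (i, j)) => /= [h|[ai jb]]; first by left; apply: reachS h.
have /= ail := reach_leq _ _ _ gT ai; have /= jbl := reach_leq _ _ _ gT jb.
have [kb|bk] := leqP k b; last by right; rewrite ail jbl.
left; apply: (@connect_trans _ _ i).
  apply: reachS sT2 _; apply: reachD1 => //.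
  by rewrite /= negb_and -!ltnNge ij orbT.
apply: (@connect_trans _ _ k); first by apply: reach1; rewrite setU11.
apply: reachS sT2 _; apply: reachD1 => //; first exact: reach_from_k.
by rewrite /= negb_and -!ltnNge ik.
Qed.

Lemma tclosureP E e : reflect (e.1 < e.2 /\ reach E e.1 e.2) (e \in tclosure E).
Proof. by rewrite inE; apply: andP. Qed.

Lemma tclosure_split1 : tclosure T1 \subset tclosure T.
Proof.
apply/subsetP=> e /tclosureP[e12 h]; apply/tclosureP; split=> //.
move: h; apply: connect_sub => x y; rewrite !inE => /predU1P[[-> ->]|/andP[_]].
  by apply: (@connect_trans _ _ j); apply: reach1.
exact: reach1.
Qed.

Lemma tclosure_split2 : tclosure T2 \subset tclosure T.
Proof.
apply/subsetP=> e /tclosureP[e12 h]; apply/tclosureP; split=> //.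
move: h; apply: connect_sub => x y; rewrite !inE => /predU1P[[-> ->]|/andP[_]].
  by apply: (@connect_trans _ _ j); apply: reach1.
exact: reach1.
Qed.

(** If [T0] lies in neither closure, it has an edge [e] lost in [T1] and an edge [f] lost in [T2].
    Then [f.1 < e.1 <= f.2 < e.2]: equality in the middle breaks alternation, strictness is a
    crossing. *)
Lemma nc_alt_trees_split : nc_alt_trees T = nc_alt_trees T1 :|: nc_alt_trees T2.
Proof.
apply/setP=> T0; rewrite !inE /spanning_tree.
case t0: (tree T0); case n0: (noncrossing T0); case a0: (alternating T0);
  rewrite ?andbF //= !andbT; apply/idP/orP => [s0|[]/subset_trans]; last 2 first.
- by apply; apply: tclosure_split1.
- by apply; apply: tclosure_split2.
case s1: (T0 \subset tclosure T1); first by left.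
case s2: (T0 \subset tclosure T2); first by right.
move/negbT/subsetPn: s1 => [e eT0 ne]; move/negbT/subsetPn: s2 => [f fT0 nf].
have /tclosureP[e12 re] := subsetP s0 e eT0.
have /tclosureP[f12 rf] := subsetP s0 f fT0.
have [re1|/andP[/andP[ie ej] ke]] := reach_split1 _ _ re.
  by case/tclosureP: ne.
have [rf1|/andP[fi /andP[jf fk]]] := reach_split2 _ _ rf.
  by case/tclosureP: nf.
have fe : f.1 < e.1 := leq_ltn_trans fi ie.
have ef : f.2 < e.2 := leq_trans fk ke.
have : e.1 <= f.2 := leq_trans ej jf.
rewrite leq_eqVlt => /predU1P[/val_inj e1f2|e1f2].
- move/alternatingP: a0 => /(_ f.1 f.2 e.2 f12 ef) []; last rewrite -e1f2;
    by rewrite -surjective_pairing.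
- move/noncrossingP: n0 => /(_ f.1 e.1 f.2 e.2 fe e1f2 ef) [];
    by rewrite -surjective_pairing.
Qed.

(** Let [J] be the component of [j] once both edges are removed. Increasing paths of [T1] never
    leave [J] and those of [T2] never enter it. An edge in both closures thus never joins [J] to its
    complement, whereas a spanning tree links [j] to [i], which is outside [J]. *)
Lemma nc_alt_trees_disjoint : [disjoint nc_alt_trees T1 & nc_alt_trees T2].
Proof.
rewrite -setI_eq0; apply/set0Pn=> -[T0]; rewrite !inE /spanning_tree.
case/andP=> /and3P[/andP[t0 /subsetP s1] _ _] /and3P[/andP[_ /subsetP s2] _ _].
pose J := linked (T :\ (i, j) :\ (j, k)) j.
have iJ : ~~ J i.
  move/bridgedP: bT => /(_ _ ijT); apply: contra => /= h.
  by rewrite linked_sym; apply: linkedS h; apply: subsetDl.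
have kJ : ~~ J k.
  move/bridgedP: bT => /(_ _ jkT); apply: contra => /= h.
  by apply: linkedS h; apply: setSD; apply: subsetDl.
have Jadj x y : (x, y) \in T :\ (i, j) :\ (j, k) -> J x = J y.
  move=> xy; have lxy := linked1 _ _ xy.
  exact: (same_connect_r (linked_sym _) lxy).
have out1 x y : reach T1 x y -> J x -> J y.
  move: x y; apply: reach_ind => // x z y xz _ IH Jx; apply: IH; move: xz Jx.
  rewrite !inE => /predU1P[[-> _]|/andP[nxz xzT]]; first by rewrite (negPf iJ).
  have [[-> _]|nxz'] := eqVneq (x, z) (i, j); first by rewrite (negPf iJ).
  by rewrite (Jadj x z) // !inE nxz nxz'.
have in2 x y : reach T2 x y -> J y -> J x.
  move: x y; apply: reach_ind => // x z y xz _ IH /IH; move: xz.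
  rewrite !inE => /predU1P[[_ ->]|/andP[nxz xzT]]; first by rewrite (negPf kJ).
  have [[_ ->]|nxz'] := eqVneq (x, z) (j, k); first by rewrite (negPf kJ).
  by rewrite (Jadj x z) // !inE nxz nxz'.
case/treeP: t0 => _ _ /(_ j i) /connectP[p]; move: (connect0 _ j : J j).
elim: p {1 2 3}j => [|z p IHp] x Jx /= => [_ ix|/andP[xz]].
  by rewrite ix Jx in iJ.
apply: IHp; case/orP: xz => xz.
- by have /tclosureP[_ /out1] := s1 _ xz; apply.
- by have /tclosureP[_ /in2] := s2 _ xz; apply.
Qed.

End Split.

(** Two consecutive edges of an increasing path would break alternation, so [T] is its own
    transitive closure; a spanning tree inside [T] omits no edge, each being a bridge. *)
Lemma nc_alt_trees_alternating T :
  tree T -> noncrossing T -> alternating T -> nc_alt_trees T = [set T].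
Proof.
move=> tT nT aT; have [gT bT _] := treeP _ tT.
have clT : tclosure T = T.
  apply/setP=> e; apply/tclosureP/idP=> [[e12]|eT]; last first.
    by split; [move/graphP: gT; apply | apply: reach1; rewrite -surjective_pairing].
  case/connectP=> -[|x [|y p]] /=; first by move=> _ h; rewrite h ltnn in e12.
    by rewrite andbT => h ex; rewrite -ex -surjective_pairing in h.
  case/and3P=> h1 h2 _ _; move/graphP: gT => gT.
  by case: ((alternatingP _ aT) _ _ _ (gT _ h1) (gT _ h2)).
apply/setP=> T0; rewrite !inE /spanning_tree clT; apply/idP/eqP=> [|->]; last first.
  by rewrite tT nT aT subxx.
case/and3P=> /andP[t0 s0] _ _; apply/eqP; rewrite eqEsubset s0.
apply/subsetP=> e eT; have [_ _ c0] := treeP _ t0; apply/negPn/negP=> ne.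
move/bridgedP: bT => /(_ _ eT)/negP; apply; apply: linkedS (c0 _ _).
by apply/subsetP=> f fT0; rewrite !inE (subsetP s0) // andbT; apply: contraNneq ne => <-.
Qed.

End Graph.
Arguments outermost {n} T i j k.

(** * Functionals invariant under reduction *)

Section ConstantCoefficient.
Variables (M : monomType) (V : zmodType) (g : M -> V).
Implicit Types (p q : {malg {poly int}[M]}).

(** The additive extension of [g] to polynomials at beta = 0. *)
Definition ctvalue p : V := \sum_(m <- msupp p) g m *~ (p@_m)`_0.

Lemma ctvalueEw (d : {fset M}) p : (msupp p `<=` d)%fset ->
  ctvalue p = \sum_(m <- d) g m *~ (p@_m)`_0.
Proof.
move=> sd; rewrite /ctvalue (big_fset_incl _ sd) // => m _.
by move=> /mcoeff_outdom ->; rewrite coef0 mulr0z.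
Qed.

Lemma ctvalueD p q : ctvalue (p + q) = ctvalue p + ctvalue q.
Proof.
have sp : (msupp p `<=` msupp p `|` msupp q)%fset by apply: fsubsetUl.
have sq : (msupp q `<=` msupp p `|` msupp q)%fset by apply: fsubsetUr.
rewrite (ctvalueEw _ _ (msuppD_le p q)) (ctvalueEw _ _ sp) (ctvalueEw _ _ sq).
by rewrite -big_split; apply: eq_bigr => m _; rewrite mcoeffD coefD mulrzDr.
Qed.

Lemma ctvalueZ (a : {poly int}) p : ctvalue (a *: p) = ctvalue p *~ a`_0.
Proof.
rewrite (ctvalueEw _ _ (msuppZ_le a p)) /ctvalue mulrz_suml.
by apply: eq_bigr => m _; rewrite mcoeffZ coef0M mulrC mulrzA.
Qed.

Lemma ctvalueU (a : {poly int}) m : ctvalue << a *g m >> = g m *~ a`_0.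
Proof.
by rewrite (ctvalueEw _ _ msuppU_le) big_seq_fset1 mcoeffUU.
Qed.

End ConstantCoefficient.
Arguments ctvalue {M V} g p.

Section ReductionInvariant.
Variables (n : nat) (M : monomType) (x : edge n -> M) (V : zmodType).
Variables (g : M -> V) (P : M -> Prop).
Local Notation mon u y v := (mmul (mmul u y) v).
Hypothesis gP : forall (u v : M) (i j k : 'I_n.+1), (i < j)%N -> (j < k)%N ->
  P (mon u (mmul (x (i, j)) (x (j, k))) v) ->
  [/\ P (mon u (mmul (x (i, k)) (x (i, j))) v),
      P (mon u (mmul (x (j, k)) (x (i, k))) v)
    & g (mon u (mmul (x (i, j)) (x (j, k))) v) =
        g (mon u (mmul (x (i, k)) (x (i, j))) v) +
        g (mon u (mmul (x (j, k)) (x (i, k))) v)].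

Let inv (p : {malg {poly int}[M]}) := forall m, (p@_m)`_0 != 0 -> P m.

Lemma red_step_invariant p q :
  red_step x p q -> inv p -> inv q /\ ctvalue g q = ctvalue g p.
Proof.
case=> u [v] [i] [j] [k] [e] [c] /= [ij jk /andP[c0 cp] ->] ip.
(* For [e > 0] the step changes no constant coefficient. *)
have [e0|e0] := posnP e; last first.
  have X0 : (c *: 'X^e : {poly int})`_0 = 0.
    by rewrite coefZ coefXn eq_sym gtn_eqF ?mulr0.
  split; last by rewrite ctvalueD ctvalueZ X0 mulr0z addr0.
  by move=> m; rewrite mcoeffD mcoeffZ coefD coef0M X0 mul0r addr0; apply: ip.
rewrite {}e0 expr0 alg_polyC in cp *.
(* The bounds on [c] make the constant coefficient of the rewritten monomial positive, so [P] holds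
   there. *)
have Pm0 : P (mon u (mmul (x (i, j)) (x (j, k))) v).
  by apply: ip; rewrite gt_eqF // (lt_le_trans c0).
have [P1 P2 gE] := gP _ _ _ _ _ ij jk Pm0; split.
  move=> m; rewrite mcoeffD mcoeffZ coefD coef0M.
  rewrite mcoeffB !mcoeffD !mcoeffU.
  have [<- //|_] := eqVneq (mon u (mmul (x (i, k)) (x (i, j))) v) m.
  have [<- //|_] := eqVneq (mon u (mmul (x (j, k)) (x (i, k))) v) m.
  have [<- //|_] := eqVneq (mon u (mmul (x (i, j)) (x (j, k))) v) m.
  by rewrite !mulr0n subr0 !add0r coefMn coefX mul0rn mulr0 addr0; apply: ip.
rewrite ctvalueD ctvalueZ -scaleN1r !ctvalueD ctvalueZ !ctvalueU gE.
rewrite !coefC coefX /= mulr0z !mulr1z addr0 coefN coef1 /= mulrN1z.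
by rewrite subrr mul0rz addr0.
Qed.

(** [P] is carried along with the value, so that [g] need only be known on irreducible monomials
    satisfying [P]. *)
Lemma reduced_form_invariant m p : P m -> reduced_form x m p ->
  (forall m', (p@_m')`_0 != 0 -> P m' /\ irreducible_monom x m') /\
  ctvalue g p = g m.
Proof.
move=> Pm [steps irr].
have [ip ->] : inv p /\ ctvalue g p = ctvalue g << m >>.
  have : inv << m >>.
    move=> m'; rewrite mcoeffU; have [<- //|_] := eqVneq m m'.
    by rewrite mulr0n coef0 eqxx.
  elim: steps => [p1 p2 /red_step_invariant st /st //|//|p1 p2 p3 _ IH1 _ IH2].
  by move=> /IH1[/IH2[? ->] ->].
split; last by rewrite ctvalueU coef1.
move=> m' nz; split; first exact: ip.
apply: irr; rewrite -mcoeff_neq0; apply: contraNneq nz => ->.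
by rewrite coef0.
Qed.

End ReductionInvariant.

(** * Good words *)

Section Words.
Variable n : nat.
Implicit Types (s t u v : seq (edge n)) (e f h : edge n).

Lemma mem_edges_of s e : (e \in edges_of s) = (e \in s).
Proof. by rewrite inE. Qed.

(* [prec e f]: the rules (i)-(iii) of good labelings put e before f. *)
Definition prec e f : bool :=
  [|| e.2 == f.1, (e.1 == f.1) && (f.2 < e.2)%N
    | (e.2 == f.2) && (f.1 < e.1)%N].

Definition well_ordered s := pairwise (fun e f => ~~ prec f e) s.

Definition good_word s :=
  [&& uniq s, tree (edges_of s), noncrossing (edges_of s) & well_ordered s].

Lemma good_tree_word s : good_tree s -> good_word s.
Proof.
case=> -[[us fs] h1 h2 h3 ncs] ts; rewrite /good_word us ts ncs /=.
have /graphP gs : graph (edges_of s) by case/andP: fs.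
have gs' e : e \in s -> (e.1 < e.2)%N by rewrite -mem_edges_of; apply: gs.
apply/(pairwiseP (ord0, ord0)) => p q; rewrite !inE => ps qs pq.
set e := nth _ s p; set f := nth _ s q.
have eS : e \in s by apply: mem_nth.
have fS : f \in s by apply: mem_nth.
have : (index e s < index f s)%N by rewrite !index_uniq.
rewrite ltnNge; apply: contra => fe; apply: ltnW.
have := gs' e eS; have := gs' f fS.
case: {ps qs pq}e f eS fS fe => [a b] [c d] /= eS fS.
rewrite /prec /= => /or3P[/eqP dx|/andP[/eqP dx lt]|/andP[/eqP dx lt]] cd ab;
  subst.
- exact: h1.
- exact: h2.
- exact: h3.
Qed.

(** * Commutation of letters and order constraints *)

Lemma disjoint_edges_sym : symmetric (@disjoint_edges n).
Proof.
suff H e f : disjoint_edges e f -> disjoint_edges f e.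
  by move=> e f; apply/idP/idP; apply: H.
rewrite /disjoint_edges /= !inE !negb_or !andbT.
by rewrite !(eq_sym f.1) !(eq_sym f.2) => /and3P[/and3P[-> -> ->] /andP[-> ->] ->].
Qed.

Lemma disjoint_edges_prec e f : disjoint_edges e f -> ~~ prec e f.
Proof.
rewrite /disjoint_edges /= !inE !negb_or !andbT /prec.
by case/and3P=> /and3P[_ /negPf-> _] /andP[/negPf-> /negPf->].
Qed.

(** Two distinct edges sharing a vertex are always compared by one of the rules (i)-(iii). *)
Lemma prec_disjoint_edges e f : (e.1 < e.2)%N -> (f.1 < f.2)%N -> e != f ->
  ~~ prec e f -> ~~ prec f e -> disjoint_edges e f.
Proof.
case: e f => [a b] [c d] /= ab cd ne; rewrite /prec /disjoint_edges /=.
rewrite !inE !negb_or !andbT => /and3P[n1 n2 n3] /and3P[n4 n5 n6].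
move: ne; rewrite xpair_eqE.
move: n1 n2 n3 n4 n5 n6; rewrite -!val_eqE /=; lia.
Qed.

Lemma monB_cons e s : monB (e :: s) = mmul (xB e) (monB s).
Proof. by rewrite /monB big_cons. Qed.

Lemma monB_cat s t : monB (s ++ t) = mmul (monB s) (monB t).
Proof. by rewrite /monB big_cat. Qed.

Lemma pi_fmonom (w : fmonom (edge n)) :
  \pi_(ncmonom n)%qT w = monB (w : seq (edge n)).
Proof.
case: w => s; rewrite /=; elim: s => [|e s IHs].
  by rewrite /monB big_nil -fmoneE.
rewrite monB_cons -IHs /xB /pcu [RHS]pcmul_pi; congr (\pi_(_)%qT _).
by rewrite fmuE /= [RHS]fmmulE.
Qed.

Definition word (m : ncmonom n) : seq (edge n) := (repr m : fmonom (edge n)).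

Lemma wordK : cancel word (@monB n).
Proof. by move=> m; rewrite /word -pi_fmonom reprK. Qed.

Lemma monB_inj_equiv s t : monB s = monB t ->
  commute_equiv (@disjoint_edges n) (FMonom s) (FMonom t).
Proof. by rewrite -!(pi_fmonom (FMonom _)) => /pcmonomP. Qed.

Lemma xBC e f : disjoint_edges e f -> mmul (xB e) (xB f) = mmul (xB f) (xB e).
Proof.
move=> ef; rewrite /xB /pcu.
transitivity (\pi_(ncmonom n)%qT (mmul (fmu e) (fmu f))); first exact: pcmul_pi.
transitivity (\pi_(ncmonom n)%qT (mmul (fmu f) (fmu e))); last first.
  by apply/esym; apply: pcmul_pi.
apply/pcmonomP/rst_step.
by have := CommuteStep mone mone ef; rewrite !mul1m !mulm1.
Qed.

Lemma xB_monBC e s : all (disjoint_edges e) s ->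
  mmul (xB e) (monB s) = mmul (monB s) (xB e).
Proof.
elim: s => [|f s IHs] /=; first by rewrite /monB big_nil mulm1 mul1m.
case/andP=> ef es; rewrite monB_cons mulmA xBC // -!mulmA; congr mmul.
exact: IHs.
Qed.

Lemma monB_filter (A : pred (edge n)) s :
    {in s &, forall e f, A e -> ~~ A f -> disjoint_edges e f} ->
  monB s = mmul (monB (filter (predC A) s)) (monB (filter A s)).
Proof.
elim: s => [|e s IHs] dA; first by rewrite /monB !big_nil mulm1.
have{IHs} IHs : monB s = mmul (monB (filter (predC A) s)) (monB (filter A s)).
  by apply: IHs => f h fs hs; apply: dA; rewrite inE ?fs ?hs orbT.
rewrite /=; case Ae: (A e); rewrite /= !monB_cons IHs ?mulmA //.
rewrite xB_monBC //; apply/allP=> f; rewrite mem_filter => /andP[Af fs].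
by apply: dA; rewrite ?inE ?eqxx ?fs ?orbT.
Qed.

(** Only disjoint edges are swapped, and [prec] does not relate these. Hence goodness is a property
    of the monomial and not of the chosen word. *)
Lemma monB_perm_well_ordered s t : monB s = monB t ->
  perm_eq s t /\ well_ordered s = well_ordered t.
Proof.
move/monB_inj_equiv; rewrite -[s]/(FMonom s : seq _) -[t]/(FMonom t : seq _).
elim=> {s t} [_ _ [u v a b ab]|//|w w' _ [pw ww]|w w' w'' _ [pw ww] _ [pw' ww']].
- rewrite !fmM !fmU /= -!catA; split.
    by rewrite perm_cat2l; apply: (permEl (perm_catCA [:: a] [:: b] v)).
  rewrite /well_ordered !pairwise_cat !allrel_catr /=.
  rewrite !allrel_consr /= !(disjoint_edges_prec _ _ ab).
  rewrite !(disjoint_edges_prec b a) 1?disjoint_edges_sym //=.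
  rewrite !allrel_consl; lia.
- by rewrite perm_sym.
- by rewrite (permPl pw) ww.
Qed.

Lemma edges_of_perm s t : perm_eq s t -> edges_of s = edges_of t.
Proof. by move=> st; apply/setP=> e; rewrite !mem_edges_of (perm_mem st). Qed.

Lemma monB_good_word s t : monB s = monB t -> good_word s = good_word t.
Proof.
move/monB_perm_well_ordered=> [st ow].
by rewrite /good_word ow (perm_uniq st) (edges_of_perm _ _ st).
Qed.

Lemma monB_edges_of s t : monB s = monB t -> edges_of s = edges_of t.
Proof. by move/monB_perm_well_ordered=> [st _]; apply: edges_of_perm. Qed.

(** Two linear extensions of the same constraints differ by commutations: the letters standing
    before the head of [s] in [t] are unrelated to it, so the head can be moved to the front. *)
Lemma monB_eq s t : perm_eq s t -> uniq s -> well_ordered s -> well_ordered t ->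
    {in s &, forall e f, e != f -> ~~ prec e f -> ~~ prec f e ->
       disjoint_edges e f} ->
  monB s = monB t.
Proof.
elim: s t => [|e s IHs] t st us ws wt dis.
  by have /nilP -> : nilp t by rewrite /nilp -(perm_size st).
have et : e \in t by rewrite -(perm_mem st) mem_head.
case/splitPr: et st wt => t1 t2 st.
rewrite /well_ordered pairwise_cat allrel_consr /=.
case/and4P=> /andP[/allP e1 a12] w1 /allP e2 w2.
have{}st : perm_eq s (t1 ++ t2).
  by rewrite -(perm_cons e) (permPl st) perm_catC /= perm_cons perm_catC.
case/andP: us => es us; case/andP: ws => /allP we ws.
rewrite monB_cons (IHs _ st) //.
- rewrite !monB_cat monB_cons !mulmA xB_monBC //; apply/allP=> f ft1.
  have fs : f \in s by rewrite (perm_mem st) mem_cat ft1.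
  apply: dis; rewrite ?mem_head ?inE ?fs ?orbT //.
  + by apply: contraNneq es => ->.
  + exact: e1.
  + exact: we.
- by rewrite /well_ordered pairwise_cat a12 w1.
- by move=> f h fs hs; apply: dis; rewrite inE ?fs ?hs orbT.
Qed.

Lemma good_wordP s : good_word s ->
  [/\ uniq s, tree (edges_of s), noncrossing (edges_of s),
      {in s, forall e, (e.1 < e.2)%N} & well_ordered s].
Proof.
case/and4P=> us ts ns ws; split=> // e; rewrite -mem_edges_of.
by case/treeP: ts => /graphP gs _ _; apply: gs.
Qed.

Lemma well_ordered_cat_prec s t e f : well_ordered (s ++ t) ->
  e \in s -> f \in t -> ~~ prec f e.
Proof.
by rewrite /well_ordered pairwise_cat => /and3P[/allrelP st _ _] /st; apply.
Qed.

Lemma split_edges_neq (i j k : 'I_n.+1) : (i < j)%N -> (j < k)%N ->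
  [/\ (i, j) != (j, k) :> edge n, (i, k) != (i, j) :> edge n
    & (i, k) != (j, k) :> edge n].
Proof. by move=> ij jk; rewrite !xpair_eqE -!val_eqE /=; split; lia. Qed.

Lemma split_edges_prec (i j k : 'I_n.+1) : (i < j)%N -> (j < k)%N ->
  ~~ prec (i, j) (i, k) /\ ~~ prec (i, k) (j, k).
Proof. by move=> ij jk; rewrite /prec -!val_eqE /=; split; lia. Qed.

(** * Reducing a good word *)

Section GoodReduction.
Variables (u v : seq (edge n)) (i j k : 'I_n.+1).
Hypotheses (ij : (i < j)%N) (jk : (j < k)%N).
Let s := u ++ [:: (i, j); (j, k)] ++ v.
Let s1 := u ++ [:: (i, k); (i, j)] ++ v.
Let s2 := u ++ [:: (j, k); (i, k)] ++ v.
Hypothesis good_s : good_word s.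

Let us : uniq s. Proof. by case/good_wordP: good_s. Qed.
Let ws : well_ordered s. Proof. by case/good_wordP: good_s. Qed.

Let mem_s e : (e \in s) = [|| e == (i, j), e == (j, k), e \in u | e \in v].
Proof. by rewrite /s mem_cat /= !inE; case: (e \in u); rewrite /= ?orbT. Qed.

Let u_ij e : e \in u -> ~~ prec (i, j) e.
Proof.
by move=> eu; apply: (well_ordered_cat_prec _ _ e (i, j) ws); rewrite ?mem_head.
Qed.

Let u_jk e : e \in u -> ~~ prec (j, k) e.
Proof.
move=> eu; apply: (well_ordered_cat_prec _ _ e (j, k) ws) => //.
by rewrite !inE eqxx orbT.
Qed.

Let v_ij e : e \in v -> ~~ prec e (i, j).
Proof.
move=> ev; move: ws; rewrite /s catA => /well_ordered_cat_prec; apply=> //.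
by rewrite mem_cat !inE eqxx orbT.
Qed.

Let v_jk e : e \in v -> ~~ prec e (j, k).
Proof.
move=> ev; move: ws; rewrite /s catA => /well_ordered_cat_prec; apply=> //.
by rewrite mem_cat !inE eqxx !orbT.
Qed.

(** A longer edge ending or starting at [j] would have to stand between [(i, j)] and [(j, k)], which
    are adjacent in [s]. *)
Lemma good_word_outermost : outermost (edges_of s) i j k.
Proof.
split; rewrite ?ij ?mem_edges_of ?mem_s ?eqxx ?orbT //.
- move=> a; rewrite mem_edges_of mem_s => /or4P[/eqP[->] //|/eqP[->]|au|av].
  + by rewrite ltnW.
  + by move: (u_ij _ au); rewrite /prec /= eqxx /= !negb_or -leqNgt => /and3P[].
  + by move: (v_jk _ av); rewrite /prec /= eqxx.
- move=> b; rewrite mem_edges_of mem_s => /or4P[/eqP[_ ->]|/eqP[->] //|bu|bv].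
  + by rewrite ltnW.
  + by move: (u_ij _ bu); rewrite /prec /= eqxx.
  + by move: (v_jk _ bv); rewrite /prec /= eqxx /= !negb_or -leqNgt => /and3P[].
Qed.

Let treeS : tree (edges_of s). Proof. by case/good_wordP: good_s. Qed.
Let ncS : noncrossing (edges_of s). Proof. by case/good_wordP: good_s. Qed.

(** Such an edge would cross [(j, k)] or [(i, j)]. This excludes the only positions where the order
    constraints on [(i, k)] do not follow from those on [(i, j)] and [(j, k)]. *)
Let not_between e : e \in s -> e \notin [:: (i, j); (j, k)] ->
  (e.1 == i -> ~~ (j <= e.2 < k)%N) /\ (e.2 == k -> ~~ (i < e.1 <= j)%N).
Proof.
move=> es; rewrite !inE negb_or => /andP[nij njk].
have eE : (e.1, e.2) \in edges_of s by rewrite -surjective_pairing mem_edges_of.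
have ijE : (i, j) \in edges_of s by rewrite mem_edges_of mem_s eqxx.
have jkE : (j, k) \in edges_of s by rewrite mem_edges_of mem_s eqxx orbT.
move/noncrossingP: ncS => nE; split=> /eqP h; apply/negP=> /andP[].
- rewrite leq_eqVlt => /predU1P[/val_inj j2|j2] e2k.
    by case/eqP: nij; rewrite [e]surjective_pairing h -j2.
  by apply: (nE i j e.2 k) => //; rewrite -h.
- move=> i1; rewrite leq_eqVlt => /predU1P[/val_inj j1|j1].
    by case/eqP: njk; rewrite [e]surjective_pairing h -j1.
  by apply: (nE i e.1 j k) => //; rewrite -h.
Qed.

Let u_ik e : e \in u -> ~~ prec (i, k) e.
Proof.
move=> eu; have es : e \in s by rewrite mem_s eu !orbT.
have ne : e \notin [:: (i, j); (j, k)].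
  apply: contraL eu => e2; move: us; rewrite cat_uniq => /and3P[_ /hasPn h _].
  by apply: h; rewrite mem_cat e2.
have [b1 b2] := not_between _ es ne; move: (u_ij _ eu) (u_jk _ eu) b1 b2.
have [_ _ _ /(_ e es) + _] := good_wordP _ good_s.
by rewrite /prec /= -!val_eqE /=; lia.
Qed.

Let v_ik e : e \in v -> ~~ prec e (i, k).
Proof.
move=> ev; have es : e \in s by rewrite mem_s ev !orbT.
have ne : e \notin [:: (i, j); (j, k)].
  move: us; rewrite /s catA cat_uniq => /and3P[_ /hasPn h _].
  by move: (h e ev); rewrite mem_cat negb_or => /andP[].
have [b1 b2] := not_between _ es ne; move: (v_ij _ ev) (v_jk _ ev) b1 b2.
have [_ _ _ /(_ e es) + _] := good_wordP _ good_s.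
by rewrite /prec /= -!val_eqE /=; lia.
Qed.

Lemma ik_fresh : (i, k) \notin s.
Proof.
by rewrite -mem_edges_of; apply: split_fresh good_word_outermost.
Qed.

Let uniq_s : [&& (i, j) \notin u ++ v, (j, k) \notin u ++ v & uniq (u ++ v)].
Proof.
by move: us; rewrite /s uniq_catCA /= inE negb_or => /and3P[/andP[_ ->] -> ->].
Qed.

Lemma edges_of_split1 :
  edges_of s1 = (i, k) |: edges_of s :\ (j, k).
Proof.
apply/setP=> e; rewrite !(mem_edges_of, in_setU1, in_setD1) mem_s mem_cat /= !inE.
have [->|njk] := eqVneq e (j, k); last first.
  by rewrite /=; case: (e \in u); rewrite /= ?orbT.
case/and3P: uniq_s => _ + _; rewrite mem_cat negb_or => /andP[/negPf-> /negPf->].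
by have [n1 _ n3] := split_edges_neq _ _ _ ij jk;
  rewrite ![(j, k) == _]eq_sym (negPf n1) (negPf n3).
Qed.

Lemma edges_of_split2 :
  edges_of s2 = (i, k) |: edges_of s :\ (i, j).
Proof.
apply/setP=> e; rewrite !(mem_edges_of, in_setU1, in_setD1) mem_s mem_cat /= !inE.
have [->|nij] := eqVneq e (i, j); last first.
  by rewrite /=; case: (e \in u); rewrite /= ?orbT //; case: (e == (j, k)); rewrite /= ?orbT.
case/and3P: uniq_s => + _ _; rewrite mem_cat negb_or => /andP[/negPf-> /negPf->].
by have [n1 n2 _] := split_edges_neq _ _ _ ij jk; rewrite (eq_sym _ (i, k)) (negPf n1) (negPf n2).
Qed.

Let ik_uv : (i, k) \notin u ++ v.
Proof. by move: ik_fresh; rewrite mem_s mem_cat !negb_or => /and4P[_ _ -> ->]. Qed.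

Let all_u_ik : all (fun e => ~~ prec (i, k) e) u. Proof. exact/allP. Qed.
Let all_v_ik : all (fun e => ~~ prec e (i, k)) v. Proof. exact/allP. Qed.

Lemma good_word_split1 : good_word s1.
Proof.
have oS := good_word_outermost; apply/and4P; split.
- rewrite /s1 uniq_catCA /= !inE negb_or ik_uv.
  case/and3P: uniq_s => -> _ ->; rewrite !andbT.
  by have [] := split_edges_neq _ _ _ ij jk.
- by rewrite edges_of_split1; apply: split_tree1 oS.
- by rewrite edges_of_split1; apply: split_noncrossing1 oS.
move: ws; rewrite /well_ordered /s /s1 /= !pairwise_cat /= !allrel_consr.
case/and5P=> /and3P[ui _ uv] wu /andP[_ vi] _ wv.
rewrite all_u_ik all_v_ik uv wu wv ui vi !andbT /=.
by have [] := split_edges_prec _ _ _ ij jk.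
Qed.

Lemma good_word_split2 : good_word s2.
Proof.
have oS := good_word_outermost; apply/and4P; split.
- rewrite /s2 uniq_catCA /= !inE negb_or ik_uv.
  case/and3P: uniq_s => _ -> ->; rewrite !andbT.
  by have [_ _] := split_edges_neq _ _ _ ij jk; rewrite eq_sym.
- by rewrite edges_of_split2; apply: split_tree2 oS.
- by rewrite edges_of_split2; apply: split_noncrossing2 oS.
move: ws; rewrite /well_ordered /s /s2 /= !pairwise_cat /= !allrel_consr.
case/and5P=> /and3P[_ uj uv] wu _ vj wv.
rewrite all_u_ik all_v_ik uv wu wv uj vj !andbT /=.
by have [] := split_edges_prec _ _ _ ij jk.
Qed.

End GoodReduction.

(** * Irreducible good words and the noncommutative functional *)

Lemma mem_split e s : e \in s -> exists u v, s = u ++ e :: v.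
Proof. by case/splitPr=> u v; exists u, v. Qed.

(** Otherwise take an outermost pair and write the word as [u], [(i, j)], [w], [(j, k)], [v]. The
    letters of [w] can be sorted so that some move left past [(i, j)] and the others right past
    [(j, k)], which makes the pair adjacent. *)
Lemma irreducible_alternating s : good_word s ->
  irreducible_monom (@xB n) (monB s) -> alternating (edges_of s).
Proof.
move=> gs irr; have [us ts nS os ws] := good_wordP _ gs.
have [gT _ _] := treeP _ _ ts; have nT := elimT (noncrossingP _ _) nS.
apply/alternatingP=> a j b aj jb ajT jbT.
have [i [k oT]] := exists_outermost _ _ _ _ _ gT ajT jbT.
case: oT => /andP[ij jk]; rewrite !mem_edges_of => ijs jks mi mk.
have pij : prec (i, j) (j, k) by rewrite /prec /= eqxx.
have [u [s' def_s]] := mem_split _ _ ijs; move: jks.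
rewrite {1}def_s mem_cat inE; case/or3P=> [jku|/eqP[ji _]|/mem_split[w [v s'E]]].
- move: ws; rewrite def_s => /well_ordered_cat_prec/(_ jku).
  by move=> /(_ _ (mem_head _ _)); rewrite pij.
- by rewrite ji ltnn in ij.
rewrite {s'}s'E in def_s.
(* The edges below [(i, j)] that end before [j] go to the right of [(j, k)]; all other letters of
   [w] go to the left of [(i, j)]. *)
pose A := fun e : edge n => (i <= e.1)%N && (e.2 < j)%N.
have ijT : (i, j) \in edges_of s.
  by rewrite mem_edges_of def_s !(mem_cat, inE) eqxx !orbT.
have mem_w e : e \in w ->
    [/\ ~~ prec e (i, j), ~~ prec (j, k) e, e != (i, j) & e != (j, k)].
  move=> ew; move: ws us; rewrite def_s /well_ordered pairwise_cat cat_uniq /=.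
  rewrite !all_cat pairwise_cat allrel_consr cat_uniq /=.
  case/and5P=> _ _ /andP[/allP/(_ _ ew) ne _] + _.
  move=> /allrelP/(_ _ _ ew (mem_head _ _)) nf.
  case/and5P=> _ _ + _ /andP[+ _].
  rewrite mem_cat => /norP[nw _] /norP[nw' _].
  by split=> //; [apply: contraNneq nw => <- | apply: contraNneq nw' => <-].
have w_os e : e \in w -> e \in s.
  by move=> ew; rewrite def_s !(mem_cat, inE) ew !orbT.
have disj_ij e : e \in w -> ~~ A e -> disjoint_edges (i, j) e.
  move=> ew nA; have [n1 n2 n3 n4] := mem_w e ew; have es := w_os e ew.
  apply: prec_disjoint_edges => //; [exact: os | by rewrite eq_sym |].
  case: e es nA n2 n4 {ew n1 n3} => [c d] /= es nA n2 n4.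
  apply/negP=> /or3P[/eqP /= jc|/andP[/eqP /= ic dj]|/andP[/eqP /= jd ci]].
  - have dk : (d <= k)%N by apply: mk; rewrite jc mem_edges_of.
    move: n2 n4; rewrite /prec /= -jc xpair_eqE eqxx /= -val_eqE ltn_neqAle dk.
    by rewrite andbT => /norP[_ /norP[/negPf-> _]].
  - by case/negP: nA; rewrite /A /= -ic leqnn.
  - by move: ci; rewrite ltnNge mi // jd mem_edges_of.
have disj_jk e : e \in w -> A e -> disjoint_edges e (j, k).
  move=> ew /andP[ie ej]; have e12 := os _ (w_os e ew); clear - ij jk ie ej e12.
  by rewrite /disjoint_edges /= !inE !negb_or -!val_eqE /=; lia.
have disj_A : {in w &, forall e f, A e -> ~~ A f -> disjoint_edges e f}.
  move=> e f ew fw Ae nAf; have := disj_ij f fw nAf; move: Ae nAf; rewrite /A.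
  have e12 := os _ (w_os e ew); have fs := w_os f fw; have f12 := os _ fs.
  rewrite -mem_edges_of [f in f \in _]surjective_pairing in fs.
  have c1 : ~~ [&& (f.1 < i)%N, (i < f.2)%N & (f.2 < j)%N].
    by apply/negP=> /and3P[h1 h2 h3]; apply: (nT f.1 i f.2 j).
  have c2 : ~~ [&& (i < f.1)%N, (f.1 < j)%N & (j < f.2)%N].
    by apply/negP=> /and3P[h1 h2 h3]; apply: (nT i f.1 j f.2).
  clear - e12 f12 c1 c2 ij; case: e f e12 f12 c1 c2 => [c d] [c' d'] /=.
  by rewrite /disjoint_edges /= !inE !negb_or -!val_eqE /=; lia.
case: (irr (mmul (monB u) (monB (filter (predC A) w)))
  (mmul (monB (filter A w)) (monB v)) i j k ij jk).
rewrite def_s monB_cat monB_cons monB_cat monB_cons (monB_filter A w disj_A).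
rewrite -!mulmA; congr mmul; rewrite !mulmA xB_monBC; last first.
  by apply/allP=> e; rewrite mem_filter => /andP[nA ew]; apply: disj_ij.
rewrite -!mulmA; congr (mmul _ (mmul _ _)); rewrite !mulmA; congr mmul.
apply/esym/xB_monBC/allP=> e; rewrite mem_filter => /andP[Ae ew].
by rewrite disjoint_edges_sym; apply: disj_jk.
Qed.

Lemma lexle_sorted T : pairwise (@lexle n) (lex_labeling T).
Proof.
rewrite -sorted_pairwise ?sort_sorted //.
- by move=> [a b] [c d]; rewrite /lexle /= -!val_eqE /=; lia.
- by move=> [a b] [c d] [a' b']; rewrite /lexle /= -!val_eqE /=; lia.
Qed.

(** Rule (i) never applies to an alternating graph, and the lexicographic order obeys rules (ii) and
    (iii), so both words extend the same constraints. *)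
Lemma monB_lex_labeling s : good_word s -> alternating (edges_of s) ->
  monB s = monB (lex_labeling (edges_of s)).
Proof.
case/good_wordP=> us ts nS os ws /alternatingP aS.
have sE : perm_eq s (lex_labeling (edges_of s)).
  apply: uniq_perm => // [|e]; first by rewrite sort_uniq enum_uniq.
  by rewrite mem_sort mem_enum mem_edges_of.
apply: monB_eq => // [|e f es fs ne]; last first.
  by apply: prec_disjoint_edges ne; apply: os.
apply: (@sub_in_pairwise _ [pred e in s] (@lexle n)); last 2 first.
- by apply/allP=> e; rewrite -(perm_mem sE).
- exact: lexle_sorted.
case=> [a b] [c d] /= es fs; have := os _ es; have := os _ fs; rewrite /= => cd ab.
rewrite /lexle /prec /= => ef; rewrite !negb_or; apply/and3P; split; last 2 first.
- by move: ef; rewrite -!val_eqE /=; lia.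
- by move: ef; rewrite -!val_eqE /=; lia.
apply/eqP=> dx; subst d; apply: (aS c a b cd ab); by rewrite mem_edges_of.
Qed.

Definition alt_tree_sum (m : ncmonom n) : {malg int[ncmonom n]} :=
  \sum_(T0 in nc_alt_trees (edges_of (word m))) << monB (lex_labeling T0) >>.

Lemma alt_tree_sumE s : alt_tree_sum (monB s) =
  \sum_(T0 in nc_alt_trees (edges_of s)) << monB (lex_labeling T0) >>.
Proof. by rewrite /alt_tree_sum (monB_edges_of (word (monB s)) s) // wordK. Qed.

Lemma good_word_monB s : good_word (word (monB s)) = good_word s.
Proof. by apply: monB_good_word; rewrite wordK. Qed.

Lemma alt_tree_sum_irreducible m : good_word (word m) ->
  irreducible_monom (@xB n) m -> alt_tree_sum m = << m >>.
Proof.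
move=> gm; rewrite -{1}(wordK m) => /(irreducible_alternating _ gm) am.
have [_ tm nm _ _] := good_wordP _ gm.
rewrite /alt_tree_sum nc_alt_trees_alternating // big_set1.
by rewrite -(monB_lex_labeling _ gm am) wordK.
Qed.

(** The functional fixes every irreducible good monomial, so its value on the reduced form is
    [beta0 PB]; additivity is the disjoint splitting of the noncrossing alternating trees. *)
Lemma beta0_reduced_form s PB : good_word s ->
  reduced_form (@xB n) (monB s) PB -> beta0 PB = alt_tree_sum (monB s).
Proof.
move=> gs redP.
have [] := reduced_form_invariant _ _ (@xB n) _ alt_tree_sum
  (fun m => good_word (word m)) _ _ _ _ redP; last first.
- move=> irrP <-; rewrite /beta0 /ctvalue mmapE; apply: eq_bigr => m _.
  rewrite horner_coef0 mul_malgC; have [->|nz] := eqVneq (PB@_m)`_0 0.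
    by rewrite scale0r mulr0z.
  have [gm im] := irrP m nz; rewrite alt_tree_sum_irreducible //.
  by rewrite -scaler_int intz.
- by rewrite good_word_monB.
move=> u v i j k ij jk; rewrite -(wordK u) -(wordK v).
have wE e f : mmul (mmul (monB (word u)) (mmul (xB e) (xB f))) (monB (word v)) =
    monB (word u ++ [:: e; f] ++ word v).
  by rewrite !monB_cat !monB_cons /monB big_nil mulm1 !mulmA.
rewrite !wE !good_word_monB !alt_tree_sumE => gw; split.
- exact: good_word_split1 gw.
- exact: good_word_split2 gw.
have oT := good_word_outermost _ _ _ _ _ ij jk gw.
have [_ tT nT _ _] := good_wordP _ gw.
rewrite (nc_alt_trees_split _ _ _ _ _ tT nT oT).
rewrite (edges_of_split1 _ _ _ _ _ ij jk gw) (edges_of_split2 _ _ _ _ _ ij jk gw).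
rewrite -bigU; last exact: (nc_alt_trees_disjoint _ _ _ _ _ tT oT).
by apply: eq_bigl => T0; rewrite in_setU.
Qed.

End Words.

(** * Counting flows *)

Section DoubleSums.
Variables (V : zmodType) (K : nat).

Lemma sum_tail (G : nat -> V) d : (forall c, (K <= c)%N -> G c = 0) ->
  \sum_(0 <= c < K | (d < c)%N) G c = \sum_(0 <= a < K) G (a + d.+1)%N.
Proof.
move=> G0; transitivity (\sum_(0 <= c < K + d.+1 | (d < c)%N) G c).
  rewrite [RHS](@big_cat_nat _ _ _ K) ?leq_addr //=.
  rewrite [X in _ = _ + X]big_nat_cond [X in _ = _ + X]big1 ?addr0 //.
  by move=> c /andP[/andP[/G0]].
rewrite (@big_cat_nat _ _ _ d.+1) ?leq_addl //=.
rewrite big_nat_cond big1 ?add0r; last by move=> c; lia.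
rewrite -{1}[d.+1]add0n big_addn addnK; apply: eq_bigl => c.
by rewrite addnS ltnS leq_addl.
Qed.

(** The parts are [d < c], [c < d] and [c = d]. For multiplicities [c.+1] and [d.+1], the new
    indices encode the smaller one as [b.+1] and the difference as [a.+1]. *)
Lemma double_sum_split (F : nat -> nat -> V) :
    (forall c d, (K <= c)%N || (K <= d)%N -> F c d = 0) ->
  \sum_(0 <= c < K) \sum_(0 <= d < K) F c d =
    \sum_(0 <= b < K) \sum_(0 <= a < K) F (a + b.+1)%N b +
    \sum_(0 <= a < K) \sum_(0 <= b < K) F b (b + a.+1)%N +
    \sum_(0 <= b < K) F b b.
Proof.
move=> F0.
have lt_part : \sum_(0 <= c < K) \sum_(0 <= d < K | (d < c)%N) F c d =
    \sum_(0 <= b < K) \sum_(0 <= a < K) F (a + b.+1)%N b.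
  rewrite (exchange_big_dep_nat predT) //=; apply: eq_bigr => b _.
  by apply: sum_tail => c Kc; rewrite F0 ?Kc.
have gt_part : \sum_(0 <= c < K) \sum_(0 <= d < K | (c < d)%N) F c d =
    \sum_(0 <= a < K) \sum_(0 <= b < K) F b (b + a.+1)%N.
  rewrite [RHS]exchange_big_nat; apply: eq_bigr => b _.
  rewrite sum_tail; last by move=> d Kd; rewrite F0 // Kd orbT.
  by apply: eq_bigr => a _; rewrite addnS addnC -addnS.
rewrite -lt_part -gt_part -!big_split /=; apply: eq_big_nat => c /andP[_ cK].
rewrite (bigID (fun d => d < c)%N) /= -addrA; congr (_ + _).
rewrite (bigID (fun d => c < d)%N) /=; congr (_ + _).
  by apply: eq_bigl => d; lia.
rewrite (eq_bigl (fun d => d == c)) => [|d /=]; last by lia.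
by rewrite big_nat1_eq cK.
Qed.

End DoubleSums.

(** * Flows on the edges and their excess *)

Section Flows.
Variable n : nat.
Implicit Types (s t : seq (edge n)) (e f : edge n) (w : nat -> nat).
Implicit Types (phi : (nat -> nat) -> int) (K d k : nat).

(* The vector sum_e c_e (e_i - e_j) is encoded by its partial sums: [w p] is the
   flow across the cut between the vertices of values p - 1 and p. *)
Definition shift w e c : nat -> nat := fun p => (w p + c * (e.1 < p <= e.2))%N.

(** The successor makes every edge carry a positive flow, from 1 to [K]. *)
Fixpoint flow_sum K s phi w : int :=
  if s is e :: s' then \sum_(0 <= c < K) flow_sum K s' phi (shift w e c.+1)
  else phi w.

(* The sum of the positive parts of the coordinates of the vector. *)
Definition excess w : nat := (\sum_(a < n.+1) (w a.+1 - w a))%N.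

(* [psi d k] is (-1)^(d-k) binom(d-1, k-1): summing it over the compositions of
   k into d' <= d positive parts, for all k, gives 1 if d' = d and 0 otherwise. *)
Fixpoint psi d k : int :=
  match d, k with
  | 0, 0 => 1
  | 0, _.+1 => 0
  | _.+1, 0 => 0
  | d'.+1, k'.+1 => psi d' k' - psi d' k'.+1
  end.

Lemma psi_gt d k : (d < k)%N -> psi d k = 0.
Proof.
elim: d k => [|d IHd] [|k] //= dk.
by rewrite !IHd ?subr0 //; lia.
Qed.

(** The recursion for [psi] makes the sum telescope, and [psi d] vanishes at the upper end. *)
Lemma sum_psi K d k : (d < k + K)%N ->
  \sum_(0 <= c < K) psi d.+1 (k + c.+1) = psi d k.
Proof.
move=> dk; transitivity (\sum_(0 <= c < K) - (psi d (k + c.+1) - psi d (k + c))).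
  by apply: eq_bigr => c _; rewrite addnS /= opprB.
by rewrite sumrN telescope_sumr // addn0 (psi_gt _ _ dk) sub0r opprK.
Qed.

Lemma shiftC w e f b c : shift (shift w e b) f c = shift (shift w f c) e b.
Proof. by apply: boolp.funext => p; rewrite /shift addnAC. Qed.

Lemma flow_sum_swap K e f s phi w :
  flow_sum K (e :: f :: s) phi w = flow_sum K (f :: e :: s) phi w.
Proof.
rewrite /= exchange_big_nat; apply: eq_bigr => c _; apply: eq_bigr => b _.
by rewrite shiftC.
Qed.

Lemma flow_sum_perm K s t phi w :
  perm_eq s t -> flow_sum K s phi w = flow_sum K t phi w.
Proof.
have rem_head e u v : e \in u ->
    flow_sum K u phi v = flow_sum K (e :: rem e u) phi v.
  elim: u v => // f u IHu v; rewrite inE /=; case: eqVneq => [-> //|nef /= eu].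
  rewrite -[RHS]/(flow_sum K (e :: f :: rem e u) phi v) flow_sum_swap.
  by apply: eq_bigr => c _; apply: IHu.
elim: s t w => [|e s IHs] t w st.
  by have /nilP -> : nilp t by rewrite /nilp -(perm_size st).
have et : e \in t by rewrite -(perm_mem st) mem_head.
rewrite (rem_head _ _ _ et) /=; apply: eq_bigr => c _; apply: IHs.
by rewrite -(perm_cons e) (permPl st) perm_to_rem.
Qed.

(* Makes the truncation c <= K in [flow_sum] harmless. *)
Definition supported K phi := forall w p,
  w 0 = 0 -> (p <= n)%N -> (K < w p)%N -> phi w = 0.

Lemma flow_sum_supported K s phi : supported K phi -> supported K (flow_sum K s phi).
Proof.
move=> sp; elim: s => //= e s IHs w p w0 pn Kp.
by rewrite big1 // => c _; apply: (IHs _ p) => //; rewrite /shift /=; lia.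
Qed.

(** The common part of the flows on [(i, j)] and [(j, k)] is sent along [(i, k)], the surplus stays
    on the edge with more flow; equal flows give the beta term. *)
Lemma flow_sum_split K s phi w (i j k : 'I_n.+1) :
    supported K phi -> w 0 = 0 -> (i < j)%N -> (j < k)%N ->
  flow_sum K ((i, j) :: (j, k) :: s) phi w =
    flow_sum K ((i, k) :: (i, j) :: s) phi w +
    flow_sum K ((j, k) :: (i, k) :: s) phi w +
    flow_sum K ((i, k) :: s) phi w.
Proof.
move=> /(flow_sum_supported _ s) sp w0 ij jk /=.
rewrite double_sum_split => [|c d cd]; last first.
  (* A multiplicity above [K] overloads the cut just below [j], or the one just below [k], and the
     summand vanishes. *)
  have [Kc|cK] := leqP K c.
    apply: (sp _ j); rewrite ?leq_ord // /shift /=; lia.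
  apply: (sp _ k); rewrite ?leq_ord // /shift /=; lia.
congr (_ + _ + _).
- do 2!apply: eq_bigr => ? _; congr flow_sum; apply: boolp.funext => p.
  rewrite /shift /=; lia.
- do 2!apply: eq_bigr => ? _; congr flow_sum; apply: boolp.funext => p.
  rewrite /shift /=; lia.
- apply: eq_bigr => ? _; congr flow_sum; apply: boolp.funext => p.
  rewrite /shift /=; lia.
Qed.

Lemma leq_excess w p : w 0 = 0 -> (p <= n.+1)%N -> (w p <= excess w)%N.
Proof.
move=> w0 pn; rewrite /excess -(big_mkord xpredT (fun a => w a.+1 - w a)%N).
rewrite (@big_cat_nat _ _ _ p) //=; apply: leq_trans (leq_addr _ _).
elim: p {pn} => [|p IHp]; first by rewrite w0.
by rewrite big_nat_recr //=; lia.
Qed.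

(** The coordinate at [e.1] is nonnegative and the one at [e.2] nonpositive, so the positive part
    grows by [c] at [e.1] and stays zero at [e.2]. *)
Lemma excess_shift w e c :
    (e.1 < e.2)%N -> (w e.1 <= w e.1.+1)%N -> (w e.2.+1 <= w e.2)%N ->
  excess (shift w e c) = (excess w + c)%N.
Proof.
move=> e12 w1 w2; transitivity (\sum_(a < n.+1) ((w a.+1 - w a) + c * (a == e.1)))%N.
  apply: eq_bigr => a _; rewrite /shift -val_eqE /=.
  have [ae|ne1] := eqVneq (val a) (val e.1).
    by rewrite ae ltnn ltnSn e12 /= muln1 muln0; lia.
  rewrite muln0 addn0; have [ae|ne2] := eqVneq (val a) (val e.2).
    by rewrite ae ltnn e12 leqnn andbF /= muln1 muln0; lia.
  have -> : (e.1 < a.+1 <= e.2)%N = (e.1 < a <= e.2)%N.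
    by move: ne1 ne2; clear => /=; lia.
  by rewrite subnDr.
rewrite big_split /= -big_distrr /=; congr addn.
by rewrite (bigD1 e.1) //= eqxx big1 ?addn0 ?muln1 // => a /negPf ->.
Qed.

Definition oriented s := all (fun e => e.1 < e.2)%N s.
Definition alternating_seq s := ~~ has (fun e => has (fun f => e.2 == f.1) s) s.

Lemma alternating_seqP s :
  reflect {in s &, forall e f, e.2 != f.1} (alternating_seq s).
Proof.
apply: (iffP hasPn) => [h e f es fs|h e es].
  by have /hasPn := h e es; apply.
by apply/hasPn=> f fs; apply: h.
Qed.

(** Every vertex is only a source or only a sink, so the flows add up in the excess without
    cancellation, and summing over one edge lowers the index of [psi] by one. *)
Lemma flow_sum_alternating K s d w : oriented s -> alternating_seq s ->
    (size s <= d)%N -> (d <= K)%N ->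
    {in s, forall e, (w e.1 <= w e.1.+1)%N && (w e.2.+1 <= w e.2)%N} ->
  flow_sum K s (fun w' => psi d (excess w')) w = psi (d - size s) (excess w).
Proof.
elim: s w => [|e s IHs] w /=; first by rewrite subn0.
case/andP=> e12 os /alternating_seqP as' sd dK ws.
have es : e \in e :: s by rewrite mem_head.
have sS f : f \in s -> f \in e :: s by rewrite inE orbC => ->.
have /andP[w1 w2] := ws e es.
have as1 : alternating_seq s.
  by apply/alternating_seqP=> f h fs hs; apply: as'; apply: sS.
transitivity (\sum_(0 <= c < K) psi (d - (size s).+1).+1 (excess w + c.+1)).
  apply: eq_bigr => c _; rewrite IHs ?excess_shift // ?subnSK // 1?ltnW // => f fs.
  (* The flow on [e] lowers only the coordinate at [e.2], which is not [f.1], and raises only the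
     one at [e.1], which is not [f.2]. *)
  have /andP[f1 f2] := ws f (sS f fs); have := as' e f es (sS f fs).
  have := as' f e (sS f fs) es; rewrite /shift -!val_eqE /=.
  have := allP os f fs => /=; lia.
by rewrite sum_psi //; lia.
Qed.

(* As the excess bounds the flow across every cut and psi n vanishes beyond n,
   the bound n.+1 on the coefficients loses nothing. *)
Definition flow_count s : int :=
  flow_sum n.+1 s (fun w => psi n (excess w)) (fun=> 0).

Lemma flow_count_perm s t : perm_eq s t -> flow_count s = flow_count t.
Proof. exact: flow_sum_perm. Qed.

Lemma flow_count_split s (i j k : 'I_n.+1) : (i < j)%N -> (j < k)%N ->
  flow_count ((i, j) :: (j, k) :: s) =
    flow_count ((i, k) :: (i, j) :: s) + flow_count ((j, k) :: (i, k) :: s) +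
    flow_count ((i, k) :: s).
Proof.
move=> ij jk; apply: flow_sum_split => // w p w0 pn wp; apply: psi_gt.
have := leq_excess w p w0; lia.
Qed.

Lemma excess0 : excess (fun=> 0) = 0.
Proof. by rewrite /excess big1. Qed.

Lemma flow_count_alternating s : oriented s -> alternating_seq s ->
  (size s <= n)%N -> flow_count s = (size s == n)%:R.
Proof.
move=> os as' sn; rewrite /flow_count flow_sum_alternating //.
rewrite excess0; case: eqVneq => [->|ne]; first by rewrite subnn.
have lt_sn : (size s < n)%N by rewrite ltn_neqAle ne.
by rewrite -(subnSK lt_sn).
Qed.

(** * Induction along reductions and flow counts of trees *)

Definition weight s := (\sum_(e <- s) (n.+1 - (e.2 - e.1)))%N.

Lemma weight_perm s t : perm_eq s t -> weight s = weight t.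
Proof. exact: perm_big. Qed.

Lemma perm_to_rem2 e f s : e != f -> e \in s -> f \in s ->
  perm_eq s [:: e, f & rem f (rem e s)].
Proof.
move=> ne es fs; apply: perm_trans (perm_to_rem es) _; rewrite perm_cons.
apply: perm_to_rem; have := fs; rewrite (perm_mem (perm_to_rem es)) inE.
by rewrite eq_sym (negPf ne).
Qed.

Lemma not_alternating_split s : oriented s -> ~~ alternating_seq s ->
  exists (i j k : 'I_n.+1) t,
    [/\ (i < j)%N, (j < k)%N & perm_eq s [:: (i, j), (j, k) & t]].
Proof.
move=> /allP os /negPn /hasP[[i j] es /hasP[[j' k] fs /= /eqP jj]]; subst j'.
have /= ij := os _ es; have /= jk := os _ fs.
exists i, j, k; eexists; split=> //; apply: perm_to_rem2 es fs.
by rewrite xpair_eqE -!val_eqE /=; lia.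
Qed.

Lemma oriented_perm s t : perm_eq s t -> oriented s = oriented t.
Proof. exact: perm_all. Qed.

(** The edge [(i, k)] is longer than [(i, j)] and [(j, k)], hence weighs less than either. *)
Lemma weight_split (i j k : 'I_n.+1) t : (i < j)%N -> (j < k)%N ->
  [/\ (weight [:: (i, k), (i, j) & t] < weight [:: (i, j), (j, k) & t])%N,
      (weight [:: (j, k), (i, k) & t] < weight [:: (i, j), (j, k) & t])%N
    & (weight ((i, k) :: t) < weight [:: (i, j), (j, k) & t])%N].
Proof.
by move=> ij jk; have := ltn_ord k; rewrite /weight !big_cons /=; split; lia.
Qed.

(** No term of the splitting has more edges than [s], so by induction on the weight all reduces to
    alternating words of fewer than [n] edges. *)
Lemma flow_count_small s : oriented s -> (size s < n)%N -> flow_count s = 0.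
Proof.
have [m] := ubnP (weight s); elim: m s => // m IHm s; rewrite ltnS => wm os sn.
have [as'|nas] := boolP (alternating_seq s).
  by rewrite flow_count_alternating // ?ltn_eqF // ltnW.
have [i [j [k [t [ij jk st]]]]] := not_alternating_split _ os nas.
have [w1 w2 w3] := weight_split _ _ _ t ij jk; have ik := ltn_trans ij jk.
rewrite (flow_count_perm _ _ st) flow_count_split //.
move: wm os sn; rewrite (weight_perm _ _ st) (oriented_perm _ _ st) (perm_size st).
rewrite /= => wm /and3P[_ _ ot] sn.
rewrite !IHm ?addr0 //= ?ij ?jk ?ik //; first [exact: leq_trans wm | lia].
Qed.

Lemma flow_count_split_top s (i j k : 'I_n.+1) : (i < j)%N -> (j < k)%N ->
    oriented s -> (size s).+2 = n ->
  flow_count ((i, j) :: (j, k) :: s) =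
    flow_count ((i, k) :: (i, j) :: s) + flow_count ((j, k) :: (i, k) :: s).
Proof.
move=> ij jk os sn; rewrite flow_count_split // (flow_count_small ((i, k) :: s)) ?addr0 //=.
  by rewrite (ltn_trans ij jk).
by lia.
Qed.

(** A commutative reduction may use pairs that are not outermost, so the invariant records only
    orientation and degree. *)
Definition top_word s := oriented s && (size s == n).

Lemma top_word_split t s0 s1 s2 (i j k : 'I_n.+1) : (i < j)%N -> (j < k)%N ->
    perm_eq s0 [:: (i, j), (j, k) & t] -> perm_eq s1 [:: (i, k), (i, j) & t] ->
    perm_eq s2 [:: (j, k), (i, k) & t] -> top_word s0 ->
  [/\ top_word s1, top_word s2
    & flow_count s0 = flow_count s1 + flow_count s2].
Proof.
move=> ij jk p0 p1 p2; rewrite /top_word (oriented_perm _ _ p0).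
rewrite (oriented_perm _ _ p1) (oriented_perm _ _ p2) (perm_size p0) (perm_size p1).
rewrite (perm_size p2) (flow_count_perm _ _ p0) (flow_count_perm _ _ p1).
rewrite (flow_count_perm _ _ p2) /= ij jk (ltn_trans ij jk) /= => /andP[os /eqP sn].
by rewrite os sn eqxx; split=> //; apply: flow_count_split_top.
Qed.

(** Induction on the weight. Splitting only at outermost pairs keeps both graphs noncrossing trees,
    and both sides are additive there; an alternating tree gives 1 on both sides. *)
Lemma flow_count_tree (T : {set edge n}) : tree T -> noncrossing T ->
  flow_count (enum T) = #|nc_alt_trees T|%:Z.
Proof.
have [m] := ubnP (weight (enum T)); elim: m T => // m IHm T; rewrite ltnS => wm tT nT.
have sT : size (enum T) = n by rewrite -cardE tree_card.
have gT : {in T, forall e, (e.1 < e.2)%N} by case/treeP: tT => /graphP.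
have oT : oriented (enum T) by apply/allP=> e; rewrite mem_enum; apply: gT.
have [as'|nas] := boolP (alternating_seq (enum T)).
  rewrite flow_count_alternating // ?sT // eqxx nc_alt_trees_alternating ?cards1 //.
  apply/alternatingP=> a b c _ _ ab bc; move/alternating_seqP: as'.
  by move=> /(_ (a, b) (b, c)); rewrite !mem_enum eqxx => /(_ ab bc).
move: nas; rewrite /alternating_seq negbK.
case/hasP=> -[a j] aT /hasP[[j' b] bT /= /eqP jj]; subst j'.
rewrite !mem_enum in aT bT; have gT' : graph T by apply/graphP.
have [i [k ot]] := exists_outermost _ _ _ _ _ gT' aT bT.
have [/andP[ij jk] ijT jkT _ _] := ot.
pose u := rem (j, k) (rem (i, j) (enum T)).
have [n1 n2 n3] := split_edges_neq _ _ _ _ ij jk.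
have pT : perm_eq (enum T) [:: (i, j), (j, k) & u].
  by apply: perm_to_rem2; rewrite ?mem_enum.
have ikT := split_fresh _ _ _ _ _ tT ot.
have [uu mem_u] : uniq u /\
    forall e, e \in u = [&& e != (i, j), e != (j, k) & e \in T].
  split; first by rewrite !rem_uniq ?enum_uniq.
  have mem_rem' e x t : uniq t -> (e \in rem x t) = (e != x) && (e \in t).
    by move=> ut; rewrite mem_rem_uniq // inE.
  by move=> e; rewrite !mem_rem' ?rem_uniq ?enum_uniq // mem_enum andbCA.
pose T1 := (i, k) |: T :\ (j, k); pose T2 := (i, k) |: T :\ (i, j).
have p1 : perm_eq (enum T1) [:: (i, k), (i, j) & u].
  apply: uniq_perm; rewrite ?enum_uniq //=.
    by rewrite inE negb_or !mem_u uu n2 (negPf ikT) eqxx !andbF.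
  move=> e; rewrite mem_enum !inE mem_u.
  have [->|_] //= := eqVneq e (i, j); first by rewrite n1 ijT orbT.
have p2 : perm_eq (enum T2) [:: (j, k), (i, k) & u].
  apply: uniq_perm; rewrite ?enum_uniq //=.
    by rewrite inE negb_or !mem_u uu eq_sym n3 (negPf ikT) eqxx !andbF.
  move=> e; rewrite mem_enum !inE mem_u.
  have [->|_] //= := eqVneq e (j, k); first by rewrite [X in ~~ X]eq_sym n1 jkT orbT.
have [w1 w2 _] := weight_split _ _ _ u ij jk.
move: wm sT oT; rewrite (weight_perm _ _ pT) (perm_size pT) (oriented_perm _ _ pT).
move=> wm /= sT /and3P[_ _ ou].
rewrite (flow_count_perm _ _ pT) (flow_count_split_top _ _ _ _ ij jk ou sT).
rewrite -(flow_count_perm _ _ p1) -(flow_count_perm _ _ p2) !IHm.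
- rewrite (nc_alt_trees_split _ _ _ _ _ tT nT ot) cardsU.
  have /disjoint_setI0 -> := nc_alt_trees_disjoint _ _ _ _ _ tT ot.
  by rewrite cards0 subn0 PoszD.
- by rewrite (weight_perm _ _ p2); apply: leq_trans wm.
- exact: split_tree2 ot.
- exact: split_noncrossing2 ot.
- by rewrite (weight_perm _ _ p1); apply: leq_trans wm.
- exact: split_tree1 ot.
- exact: split_noncrossing1 ot.
Qed.

(** * Commutative monomials as words and their reduced forms *)

Definition cword (m : {cmonom edge n}) : seq (edge n) :=
  flatten [seq nseq (m e) e | e : edge n].

Lemma count_cword m e : count_mem e (cword m) = m e.
Proof.
rewrite count_flatten -map_comp sumnE big_map big_enum /=.
rewrite (bigD1 e) //= count_nseq /= eqxx mul1n big1 ?addn0 // => f /negPf fe.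
by rewrite count_nseq /= fe.
Qed.

Definition cmon s : {cmonom edge n} := \big[mmul/mone]_(e <- s) xS e.

Lemma cmon_cons e s : cmon (e :: s) = mmul (xS e) (cmon s).
Proof. by rewrite /cmon big_cons. Qed.

Lemma cmonE s e : cmon s e = count_mem e s.
Proof.
elim: s => [|f s IHs]; first by rewrite /cmon big_nil cm1.
by rewrite cmon_cons cmM cmU IHs /=.
Qed.

Lemma cwordK : cancel cword cmon.
Proof. by move=> m; apply/eqP/cmP => e; rewrite cmonE count_cword. Qed.

Lemma cword_perm s : perm_eq (cword (cmon s)) s.
Proof. by apply/allP=> e _; rewrite /= count_cword cmonE. Qed.

Lemma cmon_cat s t : cmon (s ++ t) = mmul (cmon s) (cmon t).
Proof. by rewrite /cmon big_cat. Qed.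

Lemma cword_mul (u v : {cmonom edge n}) e f :
  perm_eq (cword (mmul (mmul u (mmul (xS e) (xS f))) v))
    [:: e, f & cword u ++ cword v].
Proof.
have -> : mmul (mmul u (mmul (xS e) (xS f))) v =
    cmon [:: e, f & cword u ++ cword v].
  by rewrite !cmon_cons cmon_cat !cwordK [mmul u _]mulmC -!mulmA.
exact: cword_perm.
Qed.

(** Any two variables can be brought together, so [(i, j)] and [(j, k)] anywhere in the word allow a
    reduction. *)
Lemma cmon_irreducible m : oriented (cword m) ->
  irreducible_monom (@xS n) m -> alternating_seq (cword m).
Proof.
move=> om im; have [//|nas] := boolP (alternating_seq (cword m)).
have [i [j [k [t [ij jk mt]]]]] := not_alternating_split _ om nas.
case: (im mone (cmon t) i j k ij jk).
rewrite -[LHS]cwordK mul1m; have -> : cmon (cword m) = cmon [:: (i, j), (j, k) & t].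
  by rewrite /cmon (perm_big _ mt).
by rewrite !cmon_cons mulmA.
Qed.

(** The flow count is 1 on each irreducible monomial that survives at beta = 0, as is the monomial
    at [x = 1]; on the initial monomial it is the count of trees. *)
Lemma evalS_reduced_form (T : {set edge n}) PS : tree T -> noncrossing T ->
  reduced_form (@xS n) (monS T) PS -> evalS 0 (fun=> 1) PS = #|nc_alt_trees T|%:Z.
Proof.
move=> tT nT redP.
have monST : monS T = cmon (enum T) by rewrite /monS /cmon big_enum.
have pT : perm_eq (cword (monS T)) (enum T) by rewrite monST cword_perm.
rewrite -flow_count_tree // -(flow_count_perm _ _ pT).
have [] := reduced_form_invariant _ _ (@xS n) _ (fun m => flow_count (cword m))
  (fun m => top_word (cword m)) _ _ _ _ redP; last first.
- move=> irrP <-; rewrite /evalS /ctvalue mmapE; apply: eq_bigr => m _.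
  rewrite horner_coef0 big1 ?mulr1 => [|e _]; last by rewrite expr1n.
  have [->|nz] := eqVneq (PS@_m)`_0 0; first by rewrite mulr0z.
  have [/andP[om /eqP sm] im] := irrP m nz.
  rewrite flow_count_alternating ?sm ?eqxx //; first by rewrite mulrzz mul1r.
  exact: cmon_irreducible.
- rewrite /top_word (oriented_perm _ _ pT) (perm_size pT) -cardE tree_card // eqxx andbT.
  by apply/allP=> e; rewrite mem_enum; case/treeP: tT => /graphP gT _ _; apply: gT.
move=> u v i j k ij jk; exact: (top_word_split _ _ _ _ _ _ _ ij jk
  (cword_mul u v _ _) (cword_mul u v _ _) (cword_mul u v _ _)).
Qed.

End Flows.

Theorem theorem2 (n : nat) (hn : (1 <= n)%N) (T : {set edge n})
    (treeT : tree T) (ncT : noncrossing T) :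
  (forall PS : {malg {poly int}[{cmonom edge n}]},
      reduced_form (@xS n) (monS T) PS ->
      evalS 0 (fun=> 1) PS = #|nc_alt_trees T|%:Z)
  /\
  (forall s : seq (edge n), edges_of s = T -> good_tree s ->
    forall PB : {malg {poly int}[ncmonom n]},
      reduced_form (@xB n) (monB s) PB ->
      beta0 PB =
        \sum_(T0 in nc_alt_trees T) << monB (lex_labeling T0) >>).
Proof.
split=> [PS|s sT gs PB redP]; first exact: evalS_reduced_form.
have gw := good_tree_word _ _ gs.
by rewrite (beta0_reduced_form _ _ _ gw redP) alt_tree_sumE sT.
Qed.
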